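(* The polynomial $R$ of twisted graph diagrams is invariant under the virtual Reidemeister moves I$^*$, II$^*$, III$^*$ and IV$^*$: if twisted graph diagrams $E$ and $E'$ differ by one such move, then $R(E)=R(E')$.
   Context: Graphs are finite, may be disconnected, may have loops and multiple edges, and may have circle components (components homeomorphic to a circle and without vertices). A twisted graph diagram is a diagram of a graph in $\mathbb{R}^2$ whose multiple points are transverse double points away from vertices, each being either a classical crossing (with over/under information) or a virtual crossing (no such information), with finitely many bars (short transverse marks) on edges or circle components. It is pure if it has no classical crossings. Surface of a pure diagram. For a pure twisted graph diagram $E$ without circle components let $S$ be the compact surface with a disk for each vertex and a band for each edge, the bands attached to the vertex disks in the cyclic order in which the edges leave the vertex in the plane, a band having a half twist for each bar on its edge (relative to the planar orientation of the disks); virtual crossings are ignored (bands pass each other without meeting). Let $k(S)$ be the number of connected components, $n(S)$ the first Betti number, $b(S)$ the number of boundary components, and $t(S)=0$ if $S$ is orientable, $t(S)=1$ otherwise. Put $M(\emptyset)=1$ and $$M(E)=(-1)^{k(S)}y^{n(S)}z^{k(S)-b(S)+n(S)}w^{t(S)}\in\mathbb{Z}[y,z,w]/(w^2-w).$$ For a pure twisted graph diagram $F$ let $o(F)$, resp. $e(F)$, be the number of circle components with an odd, resp. even (possibly zero), number of bars. Put $Q(\emptyset)=1$ and $$Q(F)(y,z,w)=(-1-y)^{e(F)}(-1-yzw)^{o(F)}\sum_{E\subset F}M(E),$$ the sum being over all subdiagrams $E$ given by spanning subgraphs (all vertices, any subset of edges) of $F$ with its circle components removed. States. At a classical crossing whose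 over-strand joins the ends SW and NE and whose under-strand joins NW and SE: spin $+1$ replaces it by two disjoint arcs joining SW to NW and SE to NE; spin $-1$ by two disjoint arcs joining SW to SE and NW to NE; spin $0$ by a vertex of degree 4. A state $S$ of a twisted graph diagram $E$ is the pure twisted graph diagram obtained by choosing a spin at every classical crossing; $\mathcal{S}(E)$ is the set of states, and $\{E\mid S\}:=a^{p-q}$ where $p,q$ are the numbers of crossings with spin $+1$, $-1$. Define $$R(E)(a,z,w)=\sum_{S\in\mathcal{S}(E)}\{E\mid S\}\,Q(S)(-a-2-a^{-1},z,w)\in\mathbb{Z}[a^{\pm1},z,w]/(w^2-w).$$ Moves (inside a disk, diagram unchanged outside): I$^*$, II$^*$, III$^*$ are the analogues of the three Reidemeister moves (kink, bigon, triangle) with all crossings virtual; IV$^*$ moves a strand crossing the edges at a vertex virtually across that vertex. *)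

(* Defs.v *)
From HB Require Import structures.
From mathcomp Require Import all_boot all_order all_algebra.

Set Implicit Arguments.
Unset Strict Implicit.
Unset Printing Implicit Defensive.

Import GRing.Theory.

(** * Polygonal surfaces

    A compact surface presented as a 2-dimensional complex.  1-cells come with
    both orientations: [pc_edge] is the type of oriented 1-cells and [pc_rev]
    (a fixed-point-free involution) reverses them.  [pc_bd f] is the closed
    edge path along which the 2-cell [f] is attached. *)

Record polycomplex := PolyComplex {
  pc_pt : finType;
  pc_edge : finType;
  pc_face : finType;
  pc_rev : pc_edge -> pc_edge;
  pc_src : pc_edge -> pc_pt;
  pc_bd : pc_face -> seq pc_edge
}.

Section PolyComplexTheory.
Variable S : polycomplex.

Definition pc_tgt (e : pc_edge S) : pc_pt S := pc_src (pc_rev e).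

Definition incidence (f : pc_face S) (e : pc_edge S) : int :=
  ((count_mem e (pc_bd f))%:Z - (count_mem (pc_rev e) (pc_bd f))%:Z)%R.

(* The number of sides of 2-cells glued along the 1-cell of [e]. *)
Definition sides (e : pc_edge S) : nat :=
  \sum_(f : pc_face S) count (fun e' => (e' == e) || (e' == pc_rev e)) (pc_bd f).

Definition on_boundary (e : pc_edge S) : bool := sides e == 1.

Definition num_components : nat :=
  n_comp [rel p q | [exists e, (pc_src e == p) && (pc_tgt e == q)]]
    (pc_pt S).

Definition num_boundary_components : nat :=
  n_comp [rel p q | [exists e, [&& on_boundary e, pc_src e == p & pc_tgt e == q]]]
    [pred p | [exists e, on_boundary e && (pc_src e == p)]].

(* Some choice of orientations of the 2-cells (reversed where [eps] is [true])
   induces opposite orientations on every 1-cell shared by two sides. *)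
Definition orientable : bool :=
  [exists eps : {ffun pc_face S -> bool}, forall e : pc_edge S,
     (sides e == 2) ==> ((\sum_f (-1) ^+ eps f * incidence f e)%R == 0%R)].

(* Cellular boundary maps over the rationals.  Rows of [boundary1] and columns
   of [boundary2] run over oriented 1-cells, so each 1-cell accounts for a pair
   of opposite rows (columns); this does not affect the ranks. *)
Definition boundary1 : 'M[rat]_(#|pc_edge S|, #|pc_pt S|) :=
  \matrix_(i, j) ((pc_tgt (enum_val i) == enum_val j)%:R
                  - (pc_src (enum_val i) == enum_val j)%:R)%R.

Definition boundary2 : 'M[rat]_(#|pc_face S|, #|pc_edge S|) :=
  \matrix_(i, j) ((incidence (enum_val i) (enum_val j))%:~R)%R.

(* dim H_1 = dim (ker boundary1) - dim (im boundary2) on the space of 1-chains,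
   whose dimension is half the number of oriented 1-cells. *)
Definition betti1 : nat :=
  #|pc_edge S|./2 - \rank boundary1 - \rank boundary2.

End PolyComplexTheory.

(** * Rotation systems

    [W : seq (seq B)] lists, for each node, the labels met counterclockwise
    around it; in the intended case every label occurs exactly twice and the two
    occurrences are joined. *)

Section Rotation.
Variables (B : choiceType) (W : seq (seq B)).

Definition halfedge : finType :=
  {i : 'I_(size W) & 'I_(size (nth [::] W i))}.

Definition he_label (h : halfedge) : B :=
  tnth (in_tuple (nth [::] W (tag h))) (tagged h).

Definition he_next (h : halfedge) : halfedge :=
  Tagged (fun i : 'I_(size W) => 'I_(size (nth [::] W i))) (ordS (tagged h)).

Definition he_prev (h : halfedge) : halfedge :=
  Tagged (fun i : 'I_(size W) => 'I_(size (nth [::] W i))) (ord_pred (tagged h)).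

Definition he_mate (h : halfedge) : halfedge :=
  odflt h [pick h' | (h' != h) && (he_label h' == he_label h)].

(* Euler's formula V - E + F = 2C.  Nodes of degree 0 have no half-edge and do
   not contribute to either side. *)
Definition planar : bool :=
  fcard he_next halfedge + fcard (he_next \o he_mate) halfedge
  == fcard he_mate halfedge
     + 2 * n_comp [rel g h | (h == he_next g) || (h == he_mate g)] halfedge.

(** ** The disk-and-band surface

    One disk per node and one band per label, with a half twist in the band [b]
    when [tw b].  The band end at the half-edge [h] is glued to the boundary of
    the disk along an arc whose endpoints, counterclockwise along the disk, are
    the corners [(h, false)] and [(h, true)].  The 1-cells starting at a corner
    are this gluing arc, the free arc of the disk boundary, and one long side of
    the band.  The boundary of a disk without band is a loop of its own. *)

Variable tw : B -> bool.

Definition corner : finType := (halfedge * bool)%type.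

Definition bare_disk : finType := {i : 'I_(size W) | nilp (nth [::] W i)}.

Definition along_gluing (c : corner) : corner := (c.1, ~~ c.2).

Definition along_disk (c : corner) : corner :=
  if c.2 then (he_next c.1, false) else (he_prev c.1, true).

(* Seen from the disks, a flat band joins a left side to a right side. *)
Definition along_band (c : corner) : corner :=
  (he_mate c.1, if tw (he_label c.1) then c.2 else ~~ c.2).

Definition db_pt : finType := (corner + bare_disk)%type.

Definition db_edge : finType :=
  (corner + corner + corner + bare_disk * bool)%type.

Definition gluing_arc (c : corner) : db_edge := inl (inl (inl c)).
Definition disk_arc (c : corner) : db_edge := inl (inl (inr c)).
Definition band_side (c : corner) : db_edge := inl (inr c).
Definition disk_loop (o : bare_disk) (s : bool) : db_edge := inr (o, s).

Definition db_src (e : db_edge) : db_pt :=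
  match e with
  | inl (inl (inl c)) | inl (inl (inr c)) | inl (inr c) => inl c
  | inr (o, _) => inr o
  end.

Definition db_rev (e : db_edge) : db_edge :=
  match e with
  | inl (inl (inl c)) => gluing_arc (along_gluing c)
  | inl (inl (inr c)) => disk_arc (along_disk c)
  | inl (inr c) => band_side (along_band c)
  | inr (o, s) => disk_loop o (~~ s)
  end.

Definition db_face : finType := ('I_(size W) + seq_sub (flatten W))%type.

Definition disk_bd (i : 'I_(size W)) : seq db_edge :=
  if insub i is Some o then [:: disk_loop o true]
  else flatten [seq [:: gluing_arc (h, false); disk_arc (h, true)]
               | h <- [seq Tagged (fun i : 'I_(size W) =>
                                     'I_(size (nth [::] W i))) j
                      | j <- enum 'I_(size (nth [::] W i))]].

Definition band_bd (b : B) : seq db_edge :=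
  if [pick h : halfedge | he_label h == b] is Some h then
    let c1 := along_gluing (h, false) in
    let c2 := along_band c1 in
    let c3 := along_gluing c2 in
    [:: gluing_arc (h, false); band_side c1; gluing_arc c2; band_side c3]
  else [::].

Definition disk_band_surface : polycomplex :=
  PolyComplex db_rev db_src
    (fun f : db_face =>
       match f with inl i => disk_bd i | inr b => band_bd (ssval b) end).

End Rotation.

(** * Twisted graph diagrams

    Planar diagram codes.  The arcs between consecutive nodes are labelled by
    natural numbers; each node carries the labels of the arc ends at it, listed
    counterclockwise.  [Joint] is a marked point in the interior of a strand: it
    allows circle components without crossings and bars to be written down, and
    has no other meaning (see [same_joint] below).  The relative position of the
    connected components of the plane image is not recorded; this only allows
    more moves. *)

Inductive node : Type :=
| Vertex of seq nat
| Classical of nat & nat & nat & nat   (* SW, SE, NE, NW; over-strand SW--NE *)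
| Virtual of nat & nat & nat & nat
| Bar of nat & nat
| Joint of nat & nat.

Definition code := seq node.

Definition ports (nd : node) : seq nat :=
  match nd with
  | Vertex s => s
  | Classical a b c d | Virtual a b c d => [:: a; b; c; d]
  | Bar a b | Joint a b => [:: a; b]
  end.

Definition rotation (E : code) : seq (seq nat) := map ports E.

Definition labels (E : code) : seq nat := flatten (rotation E).

Definition wf_code (E : code) : bool :=
  all (fun x => count_mem x (labels E) == 2) (labels E).

Record diagram := Diagram {
  diagram_code :> code;
  diagram_wf : wf_code diagram_code;
  diagram_planar : planar (rotation diagram_code)
}.

Definition is_classical (nd : node) : bool :=
  if nd is Classical _ _ _ _ then true else false.

Definition relabel_node (f : nat -> nat) (nd : node) : node :=
  match nd with
  | Vertex s => Vertex (map f s)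
  | Classical a b c d => Classical (f a) (f b) (f c) (f d)
  | Virtual a b c d => Virtual (f a) (f b) (f c) (f d)
  | Bar a b => Bar (f a) (f b)
  | Joint a b => Joint (f a) (f b)
  end.

Definition relabel (f : nat -> nat) : code -> code := map (relabel_node f).

Inductive same_node : node -> node -> Prop :=
| same_vertex n s : same_node (Vertex s) (Vertex (rot n s))
| same_classical a b c d : same_node (Classical a b c d) (Classical c d a b)
| same_virtual a b c d : same_node (Virtual a b c d) (Virtual b c d a)
| same_bar a b : same_node (Bar a b) (Bar b a)
| same_joint2 a b : same_node (Joint a b) (Joint b a).

(* Two codes of the same diagram. *)
Inductive same_diagram : code -> code -> Prop :=
| same_refl E : same_diagram E E
| same_sym E F : same_diagram E F -> same_diagram F E
| same_trans E F G : same_diagram E F -> same_diagram F G -> same_diagram E G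
| same_swap E1 m n E2 :
    same_diagram (E1 ++ m :: n :: E2) (E1 ++ n :: m :: E2)
| same_turn E1 m n E2 : same_node m n ->
    same_diagram (E1 ++ m :: E2) (E1 ++ n :: E2)
| same_relabel f E : injective f -> same_diagram E (relabel f E)
| same_joint x y E : wf_code (Joint x y :: E) -> x != y ->
    same_diagram (Joint x y :: E) (relabel (fun l => if l == y then x else l) E).

(** * Virtual moves

    [T] is the part of the diagram outside the disk of the move.  The labels
    shared by [T] and the inside are those of the strands that meet the boundary
    circle; well-formedness of the two codes makes the other inner labels fresh.
    A label at two boundary points denotes an outside arc joining them. *)

(* A strand running from [p] to [q], with the vertex on its left, and crossing
   virtually the edges listed in [legs] one after the other.  An entry
   [(x, x', s)] stands for an edge whose part on the right of the strand (towards
   the boundary of the disk) is [x] and whose part on the left (towards the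
   vertex) is [x'], and for the arc [s] of the strand just after the crossing. *)
Fixpoint virtual_strand (p : nat) (legs : seq (nat * nat * nat)) (q : nat) : code :=
  match legs with
  | [::] => [:: Joint p q]
  | (x, x', s) :: legs' => Virtual p x s x' :: virtual_strand s legs' q
  end.

Definition outer_part (l : nat * nat * nat) : nat := l.1.1.
Definition inner_part (l : nat * nat * nat) : nat := l.1.2.

Inductive virtual_move : code -> code -> Prop :=
| move_I T x y z :
    virtual_move (T ++ [:: Joint x y]) (T ++ [:: Virtual x z z y])
(* strands b1--t1 (left) and b2--t2 (right), from bottom to top *)
| move_II T b1 b2 t1 t2 l r :
    virtual_move (T ++ [:: Joint b1 t1; Joint b2 t2])
                 (T ++ [:: Virtual b1 b2 r l; Virtual l r t2 t1])
(* strands p1--p4, p2--p5, p3--p6, the p_i being counterclockwise on the circle *)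
| move_III T p1 p2 p3 p4 p5 p6 u1 u2 u3 :
    virtual_move
      (T ++ [:: Virtual p1 p2 u1 u2; Virtual u1 p3 p4 u3; Virtual u2 u3 p5 p6])
      (T ++ [:: Virtual u1 u2 p4 p5; Virtual p1 u3 u1 p6; Virtual p2 p3 u2 u3])
(* counterclockwise on the circle: p, the edges in [us], q, the edges in [ls];
   the strand p--q passes from the side of [us] to the side of [ls] *)
| move_IV T p q us ls :
    virtual_move
      (T ++ Vertex (map inner_part us ++ map outer_part ls)
         :: virtual_strand p us q)
      (T ++ Vertex (map outer_part us ++ map inner_part ls)
         :: virtual_strand q ls p).

Definition differ_by_virtual_move (E E' : code) : Prop :=
  exists C C', [/\ same_diagram E C, same_diagram E' C'
                 & virtual_move C C' \/ virtual_move C' C].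

(** * The polynomial Q of pure diagrams *)

Section Strands.
Variable F : code.

Definition arc : finType := seq_sub (labels F).

(* The strand passes straight through [nd] from one of [x], [y] to the other. *)
Definition through (x y : nat) (nd : node) : bool :=
  match nd with
  | Bar a b | Joint a b => ((x, y) == (a, b)) || ((x, y) == (b, a))
  | Virtual a b c d =>
      [|| (x, y) == (a, c), (x, y) == (c, a), (x, y) == (b, d)
        | (x, y) == (d, b)]
  | _ => false
  end.

Definition arc_rel : rel arc :=
  [rel x y | has (through (ssval x) (ssval y)) F].

Definition strand (x : nat) : {set arc} :=
  [set y | [exists x' : arc, (ssval x' == x) && connect arc_rel x' y]].

Definition strands : {set {set arc}} := [set strand (ssval x) | x : arc].

Definition lies_on (x : nat) (s : {set arc}) : bool :=
  [exists y in s, ssval y == x].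

Definition meets_vertex (s : {set arc}) : bool :=
  has (fun nd => if nd is Vertex l then has (fun x => lies_on x s) l else false) F.

Definition edges : {set {set arc}} := [set s in strands | meets_vertex s].

Definition circles : {set {set arc}} := [set s in strands | ~~ meets_vertex s].

Definition bars (s : {set arc}) : nat :=
  count (fun nd => if nd is Bar a _ then lies_on a s else false) F.

(* The surface of the spanning subgraph with edge set [X].  Two half twists of a
   band cancel, so only the parity of the number of bars is used. *)
Definition pure_surface (X : {set {set arc}}) : polycomplex :=
  disk_band_surface
    (pmap (fun nd =>
             if nd is Vertex l
             then Some [seq s <- map strand l | s \in X] else None) F)
    (fun s => odd (bars s)).

Local Open Scope ring_scope.
Variables (K : comNzRingType) (y z w : K).

(* The exponent k - b + n of z is nonnegative. *)
Definition M (X : {set {set arc}}) : K :=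
  let S := pure_surface X in
  let k := num_components S in
  let n := betti1 S in
  let b := num_boundary_components S in
  let t := ~~ orientable S in
  (-1) ^+ k * y ^+ n * z ^+ (k + n - b)%N * w ^+ t.

Definition Q : K :=
  (-1 - y) ^+ #|[set s in circles | ~~ odd (bars s)]|
  * (-1 - y * z * w) ^+ #|[set s in circles | odd (bars s)]|
  * \sum_(X in powerset edges) M X.

End Strands.

(** * States and the polynomial R *)

(* [Some true], [Some false], [None] are the spins +1, -1, 0. *)
Definition spin : finType := option bool.

Definition smooth (s : spin) (sw se ne nw : nat) : code :=
  match s with
  | Some true => [:: Joint sw nw; Joint se ne]
  | Some false => [:: Joint sw se; Joint nw ne]
  | None => [:: Vertex [:: sw; se; ne; nw]]
  end.

(* The i-th spin is used at the i-th classical crossing of the code. *)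
Fixpoint state (E : code) (spins : seq spin) : code :=
  match E with
  | [::] => [::]
  | Classical sw se ne nw :: E' =>
      smooth (head None spins) sw se ne nw ++ state E' (behead spins)
  | nd :: E' => nd :: state E' spins
  end.

Local Open Scope ring_scope.

(* Z[a^{+-1},z,w]/(w^2-w) is viewed inside Q(a,z)[w]/(w^2-w), in which it embeds
   because both are free on 1, w over Z[a^{+-1},z] and Q(a,z) respectively. *)
Definition coefField : fieldType := {fraction {poly {poly int}}}.

Definition aK : coefField := tofrac 'X.
Definition zK : coefField := tofrac 'X%:P.

Definition idem_poly : {poly coefField} := 'X^2 - 'X.

Definition Rring : comNzRingType := {poly %/ idem_poly}.

Definition R (E : code) : Rring :=
  let y := qpolyC idem_poly (- aK - 2 - aK^-1) in
  let z := qpolyC idem_poly zK in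
  let w := qpolyX idem_poly in
  \sum_(s : (count is_classical E).-tuple spin)
     qpolyC idem_poly
       (aK ^ ((count_mem (Some true) s)%:Z - (count_mem (Some false) s)%:Z))
     * Q (state E s) y z w.

(* [{poly %/ p}] silently replaces [p] by ['X] unless it is monic of positive
   degree; this is not the case here. *)
Lemma mk_monic_idem_poly : mk_monic idem_poly = idem_poly.
Proof.
have sz : (size (- 'X : {poly coefField}) < size ('X^2 : {poly coefField}))%N.
  by rewrite size_polyN size_polyX size_polyXn.
rewrite /mk_monic /idem_poly size_polyDl // size_polyXn monicE.
by rewrite lead_coefDl // lead_coefXn eqxx.
Qed.

(* Main.v *)
From HB Require Import structures.
From mathcomp Require Import all_boot all_order all_algebra.
From mathcomp Require Import zify ring.
Require Import Defs.

(* A virtual crossing joins its labels in exactly the same way as two joints, so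
   R is unchanged when every virtual crossing is replaced by two joints.  The two
   sides of a virtual move then become, state by state, pure diagrams that differ
   by contracting joints, and contracting a joint relabels the strands without
   changing the bands, their half twists, or their cyclic order at the vertices.
   The disk-and-band surfaces of corresponding subgraphs are thus isomorphic cell
   complexes, except that the boundary of a band may be read from its other end. *)

Set Implicit Arguments.
Unset Strict Implicit.
Unset Printing Implicit Defensive.

Import GRing.Theory.

(** * Isomorphic polygonal surfaces have the same invariants *)

(** Contracting a joint identifies two labels, so it is not injective on labels; it is bijective
    only on strands, which are what label the bands. Strands are therefore handled through
    representatives [rep] of classes of labels, and [Q_iso] asks only for a map of labels that is
    bijective on these classes. Well-formedness, on the other hand, bounds the occurrences of
    labels, while the surfaces need every strand to have at most two ends at vertices. This follows
    by viewing the pairs of joined labels as the edges of a graph of degree at most two. A joint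
    with equal labels is a circle component and must not be contracted; that the two labels differ
    is deduced each time from well-formedness. Smoothing a crossing only permutes the list of
    labels, so well-formedness passes to every state. *)

Lemma n_comp_bij (T T' : finType) (h : T -> T') (e : rel T) (e' : rel T')
    (a : {pred T}) (a' : {pred T'}) :
    bijective h -> symmetric e' -> closed e' a' ->
    (forall x y, e' (h x) (h y) = e x y) -> (forall x, (h x \in a') = (x \in a)) ->
  n_comp e a = n_comp e' a'.
Proof.
move=> bh sym' cl' ee' aa'.
have sym : symmetric e by move=> x y; rewrite -!ee' sym'.
rewrite (adjunction_n_comp h (sym_connect_sym sym') (sym_connect_sym sym) cl').
  by apply: eq_n_comp_r => x; rewrite inE /= aa'.
apply: strict_adjunction => //; first exact/sym_connect_sym.
- exact: bij_inj.
- by have [h' _ h'K] := bh; apply/subsetP => x _; rewrite -(h'K x) codom_f.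
Qed.

Section Rank.
Local Open Scope ring_scope.
Variable K : fieldType.

(** Selecting rows and columns and scaling rows are matrix products, so they cannot raise the rank.
    The index maps are arbitrary, which lets the bound serve for a bijection and for its inverse. *)
Lemma mxrank_reindex_le m n m' n' (A : 'M[K]_(m, n)) (B : 'M[K]_(m', n'))
    (c : 'I_m -> K) s t :
  (forall i j, A i j = c i * B (s i) (t j)) -> (\rank A <= \rank B)%N.
Proof.
move=> AB; have -> : A = diag_mx (\row_i c i) *m (rowsub s 1%:M *m B *m colsub t 1%:M).
  apply/matrixP => i j.
  by rewrite mul_diag_mx mulmx_colsub mulmx1 -rowsubE !mxE AB.
apply: leq_trans (mxrankM_maxr _ _) _.
by apply: leq_trans (mxrankM_maxl _ _) _; apply: mxrankM_maxr.
Qed.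

Lemma mxrank_reindex (A A' B B' : finType) (F : A -> B -> K) (F' : A' -> B' -> K)
    (s : A -> A') (t : B -> B') (c : A -> K) :
    bijective s -> bijective t -> (forall x, c x != 0) ->
    (forall x y, F' (s x) (t y) = c x * F x y) ->
  \rank (\matrix_(i < #|A'|, j < #|B'|) F' (enum_val i) (enum_val j)) =
  \rank (\matrix_(i < #|A|, j < #|B|) F (enum_val i) (enum_val j)).
Proof.
move=> [s' sK s'K] [t' tK t'K] c0 FF'; apply/eqP; rewrite eqn_leq; apply/andP; split.
  apply: (@mxrank_reindex_le _ _ _ _ _ _ (fun i => c (s' (enum_val i)))
    (fun i => enum_rank (s' (enum_val i))) (fun j => enum_rank (t' (enum_val j)))).
  by move=> i j; rewrite !mxE !enum_rankK -FF' s'K t'K.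
apply: (@mxrank_reindex_le _ _ _ _ _ _ (fun i => (c (enum_val i))^-1)
  (fun i => enum_rank (s (enum_val i))) (fun j => enum_rank (t (enum_val j)))).
by move=> i j; rewrite !mxE !enum_rankK FF' mulKf.
Qed.

End Rank.

Section PolycomplexIsomorphism.

Variables S S' : polycomplex.
Variables (fp : pc_pt S -> pc_pt S') (fe : pc_edge S -> pc_edge S').
Variables (ff : pc_face S -> pc_face S') (flip : pc_face S -> bool).
Hypotheses (bij_fp : bijective fp) (bij_fe : bijective fe) (bij_ff : bijective ff).
Hypothesis revK : involutive (@pc_rev S).
Hypothesis srcE : forall e, pc_src (fe e) = fp (pc_src e).
Hypothesis revE : forall e, pc_rev (fe e) = fe (pc_rev e).
(** The invariants read [pc_bd] only through numbers of occurrences, so boundary words need to agree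
    only up to order; [flip] marks the 2-cells traversed backwards. *)
Hypothesis bdE : forall f, perm_eq (pc_bd (ff f))
  (map fe (if flip f then map (@pc_rev S) (pc_bd f) else pc_bd f)).

Let fe_inj : injective fe := bij_inj bij_fe.
Let fp_inj : injective fp := bij_inj bij_fp.

Let revK' : involutive (@pc_rev S').
Proof. by have [g _ gK] := bij_fe; move=> e; rewrite -(gK e) !revE revK. Qed.

Lemma iso_tgt e : pc_tgt (fe e) = fp (pc_tgt e).
Proof. by rewrite /pc_tgt revE srcE. Qed.

Lemma iso_incidence f e :
  incidence (ff f) (fe e) = ((-1) ^+ flip f * incidence f e)%R.
Proof.
rewrite /incidence revE !(permP (bdE f)) !count_map.
have cnt e1 : count (preim fe (pred1 (fe e1))) =1 count_mem e1.
  by apply: eq_count => e2 /=; rewrite (inj_eq fe_inj).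
rewrite !cnt; case: (flip f) => /=; last by rewrite expr0 mul1r.
have cnt_rev e1 : count_mem e1 (map (@pc_rev S) (pc_bd f)) = count_mem (pc_rev e1) (pc_bd f).
  by rewrite count_map; apply: eq_count => e2 /=; rewrite (can2_eq revK revK).
by rewrite !cnt_rev revK expr1 mulN1r opprB.
Qed.

Lemma iso_sides e : sides (fe e) = sides e.
Proof.
rewrite /sides (reindex ff) /=; last exact: onW_bij.
apply: eq_bigr => f _; rewrite (permP (bdE f)) count_map revE.
case: (flip f); last by apply: eq_count => e1 /=; rewrite !(inj_eq fe_inj).
rewrite count_map; apply: eq_count => e1 /=.
by rewrite !(inj_eq fe_inj) (inv_eq revK) (inj_eq (inv_inj revK)) orbC.
Qed.

Lemma sides_rev (e : pc_edge S') : sides (pc_rev e) = sides e.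
Proof.
by apply: eq_bigr => f _; apply: eq_count => e1; rewrite revK' orbC.
Qed.

Let link_sym (P : pred (pc_edge S')) : (forall e, P (pc_rev e) = P e) ->
  symmetric [rel p q | [exists e, [&& P e, pc_src e == p & pc_tgt e == q]]].
Proof.
move=> PE p q /=; apply/existsP/existsP => -[e /and3P[Pe ep eq]];
by exists (pc_rev e); rewrite PE Pe /pc_tgt revK' ep andbT.
Qed.

Let link_iso (P : pred (pc_edge S)) (P' : pred (pc_edge S')) :
    (forall e, P' (fe e) = P e) -> forall p q,
  [exists e, [&& P' e, pc_src e == fp p & pc_tgt e == fp q]] =
  [exists e, [&& P e, pc_src e == p & pc_tgt e == q]].
Proof.
have [g _ gK] := bij_fe; move=> PP' p q.
apply/existsP/existsP => -[e].
  rewrite -(gK e) PP' srcE iso_tgt !(inj_eq fp_inj) => He.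
  by exists (g e).
by move=> He; exists (fe e); rewrite PP' srcE iso_tgt !(inj_eq fp_inj).
Qed.

Lemma iso_num_components : num_components S' = num_components S.
Proof.
rewrite /num_components; symmetry; apply: n_comp_bij bij_fp _ _ _ _ => //.
  exact: (@link_sym predT).
exact: (@link_iso predT predT).
Qed.

Lemma iso_on_boundary e : on_boundary (fe e) = on_boundary e.
Proof. by rewrite /on_boundary iso_sides. Qed.

Lemma iso_num_boundary_components :
  num_boundary_components S' = num_boundary_components S.
Proof.
have revb (e : pc_edge S') : on_boundary (pc_rev e) = on_boundary e.
  by rewrite /on_boundary sides_rev.
rewrite /num_boundary_components; symmetry; apply: n_comp_bij bij_fp _ _ _ _.
- exact: link_sym.
- apply: intro_closed; first exact/sym_connect_sym/link_sym.
  move=> p q /existsP[e /and3P[be _ /eqP <-]] _; rewrite inE.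
  by apply/existsP; exists (pc_rev e); rewrite revb be /pc_tgt eqxx.
- by apply: link_iso => e; apply: iso_on_boundary.
- move=> p; rewrite !inE; have [g _ gK] := bij_fe.
  apply/existsP/existsP => -[e].
    rewrite -(gK e) iso_on_boundary srcE (inj_eq fp_inj) => He.
    by exists (g e).
  by move=> He; exists (fe e); rewrite iso_on_boundary srcE (inj_eq fp_inj).
Qed.

(** A flipped 2-cell changes the sign of its incidences; toggling its bit in [eps] compensates for
    this. *)
Lemma iso_orientable : orientable S' = orientable S.
Proof.
have [g gK' gK] := bij_fe; have [h hK' hK] := bij_ff.
have sumE (eps : {ffun pc_face S -> bool}) (eps' : {ffun pc_face S' -> bool}) e :
    (forall f, eps' (ff f) = eps f (+) flip f) ->
  (\sum_f (-1) ^+ eps' f * incidence f (fe e) = \sum_f (-1) ^+ eps f * incidence f e)%R.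
  move=> epsE; rewrite (reindex ff) /=; last exact: onW_bij.
  by apply: eq_bigr => f _; rewrite epsE iso_incidence signr_addb -mulrA signrMK.
apply/existsP/existsP => -[eps /forallP ori].
  exists [ffun f => eps (ff f) (+) flip f]; apply/forallP => e.
  have := ori (fe e); rewrite iso_sides (sumE [ffun f => eps (ff f) (+) flip f]) //.
  by move=> f; rewrite ffunE addbK.
exists [ffun f => eps (h f) (+) flip (h f)]; apply/forallP => e.
rewrite -(gK e) iso_sides (sumE eps) //.
by move=> f; rewrite ffunE hK'.
Qed.

Lemma iso_betti1 : betti1 S' = betti1 S.
Proof.
rewrite /betti1; congr (_./2 - _ - _); first by rewrite (bij_eq_card bij_fe).
  apply: (@mxrank_reindex _ _ _ _ _
    (fun e p => (pc_tgt e == p)%:R - (pc_src e == p)%:R)%R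
    (fun e p => (pc_tgt e == p)%:R - (pc_src e == p)%:R)%R fe fp (fun=> 1%R)) => //.
  by move=> e p; rewrite iso_tgt srcE !(inj_eq fp_inj) mul1r.
apply: (@mxrank_reindex _ _ _ _ _ (fun f e => (incidence f e)%:~R)%R
  (fun f e => (incidence f e)%:~R)%R ff fe (fun f => (-1) ^+ flip f)%R) => //.
  by move=> f; rewrite signr_eq0.
by move=> f e; rewrite iso_incidence rmorphM rmorph_sign.
Qed.

End PolycomplexIsomorphism.

(** * Isomorphisms of disk-and-band surfaces *)

Lemma inj_surj_bij (T T' : finType) (h : T -> T') :
  injective h -> (forall y, exists x, h x = y) -> bijective h.
Proof.
move=> hI hS; apply: inj_card_bij => //.
rewrite -(card_codom hI) subset_leq_card //.
by apply/subsetP => y _; have [x <-] := hS y; apply: codom_f.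
Qed.

Local Notation end_at W j :=
  (Tagged (fun i : 'I_(size W) => 'I_(size (nth [::] W i))) j).

Section Halfedges.

Variables (B : choiceType) (W : seq (seq B)).
Implicit Types h : halfedge W.

Lemma halfedge_inj h h' :
  val (tag h) = val (tag h') -> val (tagged h) = val (tagged h') -> h = h'.
Proof.
case: h h' => i j [i' j'] /= /val_inj eq_i; case: i' / eq_i j' => j' /val_inj eq_j.
by rewrite eq_j.
Qed.

Lemma he_labelE b h : he_label h = nth b (nth [::] W (tag h)) (tagged h).
Proof. exact: tnth_nth. Qed.

Lemma card_he_label b : #|[pred h : halfedge W | he_label h == b]| = count_mem b (flatten W).
Proof.
rewrite -sum1_card count_flatten sumnE big_map (big_nth [::]) big_mkord.
rewrite -(@sig_big_dep _ _ _ _ (fun i : 'I_(size W) => 'I_(size (nth [::] W i)))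
  predT (fun i j => he_label (end_at W j) == b) (fun _ _ => 1)) /=.
apply: eq_bigr => i _; rewrite -sum1_count (big_nth b) big_mkord.
by apply: eq_bigl => j; rewrite (he_labelE b).
Qed.

Lemma he_labelP b : reflect (exists h : halfedge W, he_label h = b) (b \in flatten W).
Proof.
rewrite -has_pred1 has_count -card_he_label.
apply: (iffP card_gt0P) => [] [h]; first by rewrite inE => /eqP; exists h.
by move=> <-; exists h; rewrite inE eqxx.
Qed.

Lemma he_label_mem h : he_label h \in flatten W.
Proof. by apply/he_labelP; exists h. Qed.

Lemma he_nextK : cancel (@he_next B W) (@he_prev B W).
Proof. by case=> i j; rewrite /he_next /he_prev /= ordSK. Qed.

Lemma he_prevK : cancel (@he_prev B W) (@he_next B W).
Proof. by case=> i j; rewrite /he_next /he_prev /= ord_predK. Qed.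

Lemma he_mate_label h : he_label (he_mate h) = he_label h.
Proof. by rewrite /he_mate; case: pickP => //= h' /andP[_ /eqP]. Qed.

Hypothesis twice : forall b, count_mem b (flatten W) <= 2.

(** Three distinct half-edges with one label would exceed the bound [twice]. Hence the [pick] in
    [he_mate] never has more than one candidate. *)
Lemma label_twice h1 h2 h3 :
    he_label h1 = he_label h2 -> he_label h3 = he_label h2 ->
  h1 != h2 -> h3 != h2 -> h1 = h3.
Proof.
move=> e12 e32 n12 n32; apply/eqP/idPn => n13.
have := twice (he_label h2); rewrite -card_he_label leqNgt => /negP; apply.
have /card_uniqP card3 : uniq [:: h1; h2; h3].
  by rewrite /= !inE (eq_sym h2 h3) !negb_or n12 n13 n32.
apply: (@leq_trans (size [:: h1; h2; h3])) => //; rewrite -card3.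
apply: subset_leq_card; apply/subsetP => h; rewrite !inE.
by case/or3P => /eqP ->; rewrite ?e12 ?e32.
Qed.

Lemma he_mate_eq h h' : h' != h -> he_label h' = he_label h -> he_mate h = h'.
Proof.
move=> nh eh; rewrite /he_mate; case: pickP => [h2 /= /andP[n2 /eqP e2]|/(_ h')].
  exact: (@label_twice h2 h h').
by rewrite nh eh eqxx.
Qed.

Lemma he_mateK : involutive (@he_mate B W).
Proof.
(* A half-edge whose label occurs only once is its own mate, by the default in [he_mate]. *)
move=> h; have [e|ne] := eqVneq (he_mate h) h; first by rewrite e.
by apply: he_mate_eq; rewrite 1?eq_sym ?he_mate_label.
Qed.

Lemma db_revK tw : involutive (@db_rev B W tw).
Proof.
case=> [[[[h s]|[h s]]|[h s]]|[o s]] /=; rewrite ?negbK //.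
- by rewrite /gluing_arc /along_gluing /= negbK.
- by rewrite /disk_arc /along_disk; case: s; rewrite /= ?he_nextK ?he_prevK.
rewrite /band_side /along_band /= he_mate_label he_mateK.
by case: (tw _) => /=; rewrite ?negbK.
Qed.

End Halfedges.

Section DiskBandIsomorphism.

Variables (B B' : choiceType) (W : seq (seq B)) (W' : seq (seq B')).
Variables (tw : B -> bool) (tw' : B' -> bool) (f : B -> B').
Variables (sigma : 'I_(size W) -> 'I_(size W')) (phi : halfedge W -> halfedge W').
Hypothesis twice : forall b, count_mem b (flatten W) <= 2.
Hypothesis f_inj : {in flatten W &, injective f}.
Hypothesis twE : {in flatten W, forall b, tw' (f b) = tw b}.
Hypotheses (bij_sigma : bijective sigma) (bij_phi : bijective phi).
Hypothesis size_sigma : forall i, size (nth [::] W' (sigma i)) = size (nth [::] W i).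
Hypothesis tagE : forall h, tag (phi h) = sigma (tag h).
Hypothesis nextE : forall h, he_next (phi h) = phi (he_next h).
Hypothesis labelE : forall h, he_label (phi h) = f (he_label h).

Let phi_inj : injective phi := bij_inj bij_phi.
Let sigma_inj : injective sigma := bij_inj bij_sigma.

Let phi_surj h' : exists h, phi h = h'.
Proof. by have [g _ gK] := bij_phi; exists (g h'). Qed.

Let label_inj (h1 h2 : halfedge W) : f (he_label h1) = f (he_label h2) -> he_label h1 = he_label h2.
Proof. by apply: f_inj; apply: he_label_mem. Qed.

Let prevE h : he_prev (phi h) = phi (he_prev h).
Proof. by rewrite -{1}[h]he_prevK -nextE he_nextK. Qed.

(** Three half-edges of [W'] with one label pull back along [phi] to three of [W], whose labels
    agree because [f] is injective on labels. *)
Let twice' b : count_mem b (flatten W') <= 2.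
Proof.
rewrite -card_he_label leqNgt; apply/negP; rewrite cardE => lt2.
move: (mem_enum [pred h : halfedge W' | he_label h == b]) (enum_uniq [pred h : halfedge W' | he_label h == b]).
case: (enum _) lt2 => [|h1 [|h2 [|h3 s]]] //= _ inb.
have lb h : h \in [:: h1, h2, h3 & s] -> he_label h = b by rewrite inb inE => /eqP.
have := (lb h1, lb h2, lb h3); rewrite !inE !eqxx !orbT => -[[/(_ isT) e1 /(_ isT) e2] /(_ isT) e3].
rewrite !negb_or => /and3P[/and3P[n12 n13 _] /andP[n23 _] _].
move: e1 e2 e3 n12 n13 n23.
have [g1 <-] := phi_surj h1; have [g2 <-] := phi_surj h2; have [g3 <-] := phi_surj h3.
rewrite !labelE !(inj_eq phi_inj) => <- /label_inj e2 /label_inj e3 n12 n13 n23.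
by move: n13; rewrite (@label_twice _ _ twice g1 g2 g3) ?eqxx ?e2 ?e3 // eq_sym.
Qed.

Let mateE h : he_mate (phi h) = phi (he_mate h).
Proof.
rewrite {2}/he_mate; case: pickP => [h1 /= /andP[n1 /eqP e1]|no] /=.
  by apply: he_mate_eq => //; rewrite ?(inj_eq phi_inj) // !labelE e1.
rewrite /he_mate; case: pickP => //= h1; have [h2 <-] := phi_surj h1.
rewrite (inj_eq phi_inj) !labelE => /andP[n2 /eqP/label_inj e2].
by have := no h2; rewrite n2 e2 eqxx.
Qed.

Let fc (c : corner W) : corner W' := (phi c.1, c.2).

Let nilp_sigma i : nilp (nth [::] W' (sigma i)) = nilp (nth [::] W i).
Proof. by rewrite /nilp size_sigma. Qed.

Let fo_proof (o : bare_disk W) : nilp (nth [::] W' (sigma (val o))).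
Proof. by rewrite nilp_sigma; apply: (valP o). Qed.

Let fo (o : bare_disk W) : bare_disk W' := exist _ (sigma (val o)) (fo_proof o).

Let fb_proof (b : seq_sub (flatten W)) : f (ssval b) \in flatten W'.
Proof. by case: b => b /= /he_labelP[h <-]; rewrite -labelE he_label_mem. Qed.

Let fb (b : seq_sub (flatten W)) : seq_sub (flatten W') := SeqSub (fb_proof b).

Let fp (p : db_pt W) : db_pt W' :=
  match p with inl c => inl (fc c) | inr o => inr (fo o) end.

Let fe (e : db_edge W) : db_edge W' :=
  match e with
  | inl (inl (inl c)) => gluing_arc (fc c)
  | inl (inl (inr c)) => disk_arc (fc c)
  | inl (inr c) => band_side (fc c)
  | inr (o, s) => disk_loop (fo o) s
  end.

Let ff (x : db_face W) : db_face W' :=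
  match x with inl i => inl (sigma i) | inr b => inr (fb b) end.

(* The [pick]s in [band_bd] may start the two copies of a band at different
   ends, which reverses the boundary path when the band has a half twist. *)
Let flip (x : db_face W) : bool :=
  match x with
  | inl _ => false
  | inr b =>
      if [pick h : halfedge W | he_label h == ssval b] is Some h then
        if [pick h' : halfedge W' | he_label h' == f (ssval b)] is Some h' then
          (h' != phi h) && tw (ssval b)
        else false
      else false
  end.

Let bij_fc : bijective fc.
Proof.
have [g gK gK'] := bij_phi.
by exists (fun c => (g c.1, c.2)) => -[h s]; rewrite /fc /= ?gK ?gK'.
Qed.

Let bij_fo : bijective fo.
Proof.
apply: inj_surj_bij => [o1 o2 [/sigma_inj/val_inj //]|[i ni]].
have [g _ gK] := bij_sigma; rewrite -(gK i) in ni *.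
have ni1 := ni; rewrite nilp_sigma in ni1.
by exists (exist _ (g i) ni1); apply: val_inj.
Qed.

Let bij_fb : bijective fb.
Proof.
apply: inj_surj_bij => [[b1 m1] [b2 m2] [/f_inj e]|[b mb]].
  by apply: val_inj; apply: e.
have [h' e'] := he_labelP _ _ mb; have [h e] := phi_surj h'.
exists (SeqSub (he_label_mem h)); apply: val_inj => /=.
by rewrite -labelE e.
Qed.

Let bij_fp : bijective fp.
Proof.
have [g gK gK'] := bij_fc; have [k kK kK'] := bij_fo.
exists (fun p => match p with inl c => inl (g c) | inr o => inr (k o) end);
by case=> x /=; rewrite ?gK ?gK' ?kK ?kK'.
Qed.

Let bij_ff : bijective ff.
Proof.
have [g gK gK'] := bij_sigma; have [k kK kK'] := bij_fb.
exists (fun p => match p with inl c => inl (g c) | inr o => inr (k o) end);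
by case=> x /=; rewrite ?gK ?gK' ?kK ?kK'.
Qed.

Let bij_fe : bijective fe.
Proof.
have [g gK gK'] := bij_fc; have [k kK kK'] := bij_fo.
exists (fun e => match e with
  | inl (inl (inl c)) => gluing_arc (g c)
  | inl (inl (inr c)) => disk_arc (g c)
  | inl (inr c) => band_side (g c)
  | inr (o, s) => disk_loop (k o) s
  end); by case=> [[[c|c]|c]|[o s]] /=; rewrite ?gK ?gK' ?kK ?kK'.
Qed.

Let srcE e : db_src (fe e) = fp (db_src e).
Proof. by case: e => [[[c|c]|c]|[o s]]. Qed.

Let revE e : db_rev tw' (fe e) = fe (db_rev tw e).
Proof.
case: e => [[[c|c]|c]|[o s]] //=.
  by rewrite /along_disk /fc /=; case: (c.2); rewrite ?nextE ?prevE.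
by rewrite /along_band /fc /= mateE labelE twE // he_label_mem.
Qed.

(** Both boundary words start at position 0 of their row, a starting point that [phi] need not
    respect; hence equality only up to order. *)
Let disk_bdE i : perm_eq (disk_bd (sigma i)) (map fe (disk_bd i)).
Proof.
rewrite /disk_bd; case: insubP => [o' no' eo'|no'].
  case: insubP => [o no eo|]; last by rewrite -nilp_sigma no'.
  by rewrite (_ : o' = fo o) //; apply: val_inj; rewrite eo' /= eo.
case: insubP => [o no eo|no]; first by rewrite -nilp_sigma (negbTE no') in no.
rewrite map_flatten -map_comp.
set hs := [seq end_at W j | j <- enum 'I_(size (nth [::] W i))].
set hs' := [seq end_at W' j | j <- enum 'I_(size (nth [::] W' (sigma i)))].
have memE (B1 : choiceType) (W1 : seq (seq B1)) (i1 : 'I_(size W1)) (h : halfedge W1) :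
  (h \in [seq end_at W1 j | j <- enum 'I_(size (nth [::] W1 i1))]) = (tag h == i1).
  apply/mapP/eqP => [[j _ -> //]|]; case: h => i2 j2 /= e; case: i1 / e.
  by exists j2; rewrite ?mem_enum.
have uniqE (B1 : choiceType) (W1 : seq (seq B1)) (i1 : 'I_(size W1)) :
  uniq [seq end_at W1 j | j <- enum 'I_(size (nth [::] W1 i1))].
  by rewrite map_inj_uniq ?enum_uniq // => j1 j2 /eqP; rewrite eq_Tagged => /eqP.
have hsE : perm_eq hs' (map phi hs).
  apply: uniq_perm => [||h']; [exact: uniqE|rewrite (map_inj_uniq phi_inj) |]. exact: (uniqE B W i).
  have [h <-] := phi_surj h'; rewrite mem_map // !memE tagE.
  by rewrite (inj_eq sigma_inj).
have /perm_trans -> // := perm_flatten (perm_map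
  (fun h => [:: gluing_arc (h, false); disk_arc (h, true)]) hsE).
by rewrite -map_comp.
Qed.

Let bdE x : perm_eq
  (match ff x with inl i => disk_bd i | inr b => band_bd W' tw' (ssval b) end)
  (map fe (let bd := match x with inl i => disk_bd i | inr b => band_bd W tw (ssval b) end in
           if flip x then map (@db_rev _ W tw) bd else bd)).
Proof.
case: x => [i|b]; first exact: disk_bdE.
rewrite /= /band_bd; case: pickP => [h' /eqP eh'|no]; last first.
  by case/he_labelP: (fb_proof b) => h' /eqP; rewrite no.
case: pickP => [h /eqP eh|no]; last first.
  by case/he_labelP: (ssvalP b) => h /eqP; rewrite no.
have [->|nh'] /= := eqVneq h' (phi h).
  by rewrite /along_band /along_gluing /= mateE labelE twE ?he_label_mem //.
(* A label has at most two half-edges, so the only other possible start is the mate. *)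
have {nh'} [nh ->] : he_mate h != h /\ h' = phi (he_mate h).
  have e : he_label h' = he_label (phi h) by rewrite labelE eh eh'.
  have mE := he_mate_eq twice' nh' e; rewrite -mE mateE.
  by rewrite -mE mateE (inj_eq phi_inj) in nh'.
rewrite -eh /along_band /along_gluing /= mateE !labelE !twE ?he_label_mem //.
rewrite !he_mate_label he_mateK //.
(* From the other end, a flat band gives a cyclic rotation of the same word and a half-twisted one
   gives the reversed word; this is why [flip] tests [tw]. *)
by case: (tw _) => /=; apply/permP => P; rewrite /fc /= ?he_mate_label ?he_mateK //; lia.
Qed.

(** [sigma] is given besides [phi] because a vertex without bands has no half-edge: its bare disk is
    invisible to [phi]. *)
Lemma disk_band_iso :
  let S := disk_band_surface W tw in let S' := disk_band_surface W' tw' in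
  [/\ num_components S' = num_components S, betti1 S' = betti1 S,
      num_boundary_components S' = num_boundary_components S
    & orientable S' = orientable S].
Proof.
have revK := db_revK twice tw.
split.
- exact: (@iso_num_components (disk_band_surface W tw) (disk_band_surface W' tw') fp fe).
- exact: (@iso_betti1 (disk_band_surface W tw) (disk_band_surface W' tw') fp fe ff flip).
- exact: (@iso_num_boundary_components (disk_band_surface W tw) (disk_band_surface W' tw') fp fe ff flip).
- exact: (@iso_orientable (disk_band_surface W tw) (disk_band_surface W' tw') fe ff flip).
Qed.

End DiskBandIsomorphism.

(** * Rotation systems up to reordering the vertices and rotating each row *)

Lemma nth_rot_mod (T : Type) (x : T) n s j :
  n <= size s -> j < size s -> nth x (rot n s) j = nth x s ((j + n) %% size s).
Proof.
move=> ns js; rewrite /rot nth_cat size_drop nth_drop.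
case: ltnP => [lt|ge]; first by rewrite modn_small 1?addnC //; lia.
rewrite nth_take; last by lia.
have -> : j + n = j - (size s - n) + size s by lia.
by rewrite modnDr modn_small //; lia.
Qed.

Lemma filter_rot (T : Type) (p : pred T) n (s : seq T) :
  filter p (rot n s) = rot (count p (take n s)) (filter p s).
Proof.
by rewrite {1}/rot filter_cat -size_filter -rot_size_cat -filter_cat cat_take_drop.
Qed.

(** Rows are matched through their indices, so that equal rows, such as several empty ones, remain
    distinct vertices. The bound on [r i] makes the rotation a shift of positions modulo the length
    of the row. *)
Definition cyclic_iso (T : Type) (V V' : seq (seq T)) : Prop :=
  size V = size V' /\ exists sigma r : nat -> nat,
    (forall i j, i < size V -> j < size V -> sigma i = sigma j -> i = j) /\
    forall i, i < size V ->
      [/\ sigma i < size V', r i <= size (nth [::] V' (sigma i))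
        & nth [::] V i = rot (r i) (nth [::] V' (sigma i))].

Lemma cyclic_iso_map (T T' : Type) (h : T -> T') V V' :
  cyclic_iso V V' -> cyclic_iso (map (map h) V) (map (map h) V').
Proof.
move=> [eqs [sigma [r [sI rP]]]]; split; first by rewrite !size_map.
exists sigma, r; rewrite !size_map; split=> // i iV; have [iV' ri e] := rP i iV.
by rewrite !(nth_map [::]) // size_map e map_rot.
Qed.

(** Passing to a spanning subgraph deletes labels from the rows; a rotation by [r i] becomes the
    rotation by the number of labels kept among the first [r i]. *)
Lemma cyclic_iso_filter (T : Type) (p : pred T) V V' :
  cyclic_iso V V' -> cyclic_iso (map (filter p) V) (map (filter p) V').
Proof.
move=> [eqs [sigma [r [sI rP]]]]; split; first by rewrite !size_map.
exists sigma, (fun i => count p (take (r i) (nth [::] V' (sigma i)))).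
rewrite !size_map; split=> // i iV; have [iV' ri e] := rP i iV.
rewrite !(nth_map [::]) // e filter_rot size_filter; split=> //.
by rewrite -[X in _ <= count p X](cat_take_drop (r i)) count_cat leq_addr.
Qed.

Lemma cyclic_iso_perm (T : eqType) (V V' : seq (seq T)) :
  perm_eq V V' -> cyclic_iso V V'.
Proof.
move=> pV; split; first exact: perm_size.
have /(perm_iotaP [::])[s ps ->] := pV.
have ss := perm_size ps; rewrite size_iota in ss.
exists (nth 0 s), (fun=> 0); rewrite size_map ss.
have us : uniq s by rewrite (perm_uniq ps) iota_uniq.
split=> [i j iV jV /eqP|i iV]; first by rewrite nth_uniq ?ss // => /eqP.
rewrite rot0 (nth_map 0) ?ss //; split=> //.
by have := mem_nth 0 (s := s) (n := i); rewrite ss (perm_mem ps) mem_iota add0n => /(_ iV).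
Qed.

Lemma cyclic_iso_rot (T : Type) n (s : seq T) V1 V2 :
  cyclic_iso (V1 ++ rot n s :: V2) (V1 ++ s :: V2).
Proof.
split; first by rewrite !size_cat.
(* [rot n] is trivial beyond the length of [s], so truncating [n] there changes nothing and meets
   the bound in [cyclic_iso]. *)
exists id, (fun i => if i == size V1 then minn n (size s) else 0).
split=> // i iV; rewrite size_cat /= in iV *.
have [->|ne] := eqVneq i (size V1).
  by rewrite !nth_cat ltnn subnn /= -rot_minn geq_minr size_cat addnS ltnS leq_addr.
rewrite rot0 !nth_cat size_cat iV; split=> //; case: ltnP => // le.
by have -> : i - size V1 = (i - size V1).-1.+1 by lia.
Qed.

Section CyclicIso.

Variables (B B' : choiceType) (W : seq (seq B)) (W' : seq (seq B')).
Variables (tw : B -> bool) (tw' : B' -> bool) (f : B -> B').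
Hypothesis twice : forall b, count_mem b (flatten W) <= 2.
Hypothesis f_inj : {in flatten W &, injective f}.
Hypothesis twE : {in flatten W, forall b, tw' (f b) = tw b}.
Hypothesis iso : cyclic_iso (map (map f) W) W'.

(** Position [j] of a row rotated by [r] is position [j + r], modulo the length, of the unrotated
    row. This shift is the map [phi] of half-edges, and it commutes with the cyclic successor. *)
Lemma disk_band_cyclic_iso :
  let S := disk_band_surface W tw in let S' := disk_band_surface W' tw' in
  [/\ num_components S' = num_components S, betti1 S' = betti1 S,
      num_boundary_components S' = num_boundary_components S
    & orientable S' = orientable S].
Proof.
have [eqs [sg [r [sgI rP]]]] := iso; rewrite !size_map in eqs sgI rP.
have sgP i (iW : i < size W) : sg i < size W' by have [] := rP i iW.
pose sigma (i : 'I_(size W)) : 'I_(size W') := Ordinal (sgP i (ltn_ord i)).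
have rowE (i : 'I_(size W)) :
    map f (nth [::] W i) = rot (r i) (nth [::] W' (sigma i)).
  by have [_ _ <-] := rP i (ltn_ord i); rewrite (nth_map [::]).
have size_sigma (i : 'I_(size W)) :
    size (nth [::] W' (sigma i)) = size (nth [::] W i).
  by have := congr1 size (rowE i); rewrite size_map size_rot.
have r_le (i : 'I_(size W)) : r i <= size (nth [::] W i).
  by rewrite -size_sigma; have [] := rP i (ltn_ord i).
have phiP (h : halfedge W) :
    (tagged h + r (tag h)) %% size (nth [::] W (tag h)) < size (nth [::] W' (sigma (tag h))).
  by rewrite size_sigma ltn_mod; apply: leq_ltn_trans (ltn_ord (tagged h)).
pose phi (h : halfedge W) : halfedge W' :=
  Tagged (fun i : 'I_(size W') => 'I_(size (nth [::] W' i)))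
    (Ordinal (phiP h) : 'I_(size (nth [::] W' (sigma (tag h))))).
have sigma_inj : injective sigma.
  by move=> i j [/sgI e]; apply: val_inj; apply: e.
have bij_sigma : bijective sigma by apply: inj_card_bij; rewrite // !card_ord eqs.
have phi_inj : injective phi.
  case=> [i1 j1] [i2 j2] e.
  have e1 : i1 = i2 by apply: sigma_inj; apply: (congr1 tag e).
  case: i2 / e1 j2 e => j2 e; apply: halfedge_inj => //=.
  have /eqP := congr1 (fun h : halfedge W' => val (tagged h)) e.
  by rewrite /= eqn_modDr !modn_small // => /eqP.
have bij_phi : bijective phi.
  apply: inj_surj_bij => // -[i' j'].
  have [g _ gK] := bij_sigma; rewrite -(gK i') in j' *.
  set i := g i' in j' *; set n := size (nth [::] W i).
  have lj' : j' < n by rewrite /n -size_sigma ltn_ord.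
  have lj : (j' + (n - r i)) %% n < n by rewrite ltn_mod; lia.
  exists (Tagged (fun i : 'I_(size W) => 'I_(size (nth [::] W i))) (Ordinal lj)).
  apply: halfedge_inj => //=; rewrite modnDml -addnA subnK ?r_le // modnDr.
  by rewrite modn_small.
apply: (@disk_band_iso _ _ W W' tw tw' f sigma phi) => // h.
  apply: halfedge_inj => //=.
  by rewrite size_sigma modnDml -addn1 modnDml addn1 addSn.
have b := f (he_label h).
rewrite (he_labelE b) /= -{2}size_sigma -nth_rot_mod; last 2 first.
- by rewrite size_sigma.
- by rewrite size_sigma.
by rewrite -rowE (nth_map (he_label h)) // -he_labelE.
Qed.

End CyclicIso.

(** * Strands of a pure diagram *)

(* Union-find: [rep P] picks a representative of the class of a label for the
   equivalence relation generated by the pairs in [P]. *)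
Fixpoint rep (P : seq (nat * nat)) (x : nat) : nat :=
  if P is p :: P' then
    if rep P' x == rep P' p.2 then rep P' p.1 else rep P' x
  else x.

Lemma rep_pair P p : p \in P -> rep P p.1 = rep P p.2.
Proof.
elim: P => //= q P IH; rewrite inE => /predU1P[->|/IH ->] //.
by rewrite eqxx; case: eqP.
Qed.

Definition respects (T : eqType) (k : nat -> T) (P : seq (nat * nat)) : bool :=
  all (fun p => k p.1 == k p.2) P.

Lemma rep_respects P : respects (rep P) P.
Proof. by apply/allP => p /rep_pair/eqP. Qed.

(** Passing to the representative only follows pairs of [P], which [k] cannot distinguish. With
    [rep_respects] this is the universal property of the quotient: two lists of pairs can be
    compared through the functions that respect them. *)
Lemma respects_rep (T : eqType) (k : nat -> T) P x :
  respects k P -> k (rep P x) = k x.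
Proof.
elim: P x => //= q P IH x /andP[/eqP kq kP].
by case: eqP => e; rewrite IH // kq -(IH q.2) // -e IH.
Qed.

Definition ends (P : seq (nat * nat)) : seq nat :=
  flatten [seq [:: p.1; p.2] | p <- P].

(* In the induction step the two ends of the first pair join the list [V]: if
   their classes differ, each of the two has room for one more element of [V]. *)
Lemma rep_class_count P V :
    (forall x, count_mem x (ends P ++ V) <= 2) ->
  forall c, count (fun v => rep P v == c) V <= 2.
Proof.
elim: P V => [|[a b] P IH] V le2 c; first exact: le2.
have {}IH : forall c, count (fun v => rep P v == c) [:: a, b & V] <= 2.
  apply: IH => x; have := le2 x.
  by rewrite -[ends (_ :: _)]/[:: a, b & ends P] !count_cat /=; lia.
have [e|ne] := eqVneq (rep P a) (rep P b).
  rewrite (@eq_count _ _ (fun v => rep P v == c)); last first.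
    by move=> v /=; have [->|//] := eqVneq (rep P v) (rep P b); rewrite e.
  by apply: leq_trans (IH c) => /=; lia.
have [->|nc] := eqVneq c (rep P a).
  have := IH (rep P a); have := IH (rep P b); rewrite /= !eqxx (negbTE ne) (eq_sym (rep P b)) (negbTE ne) /= => leb lea.
  apply: (@leq_trans (count (fun v => rep P v == rep P a) V + count (fun v => rep P v == rep P b) V)); last by lia.
  rewrite -count_predUI (leq_trans _ (leq_addr _ _)) //; apply: sub_count => v /=.
  by case: (rep P v == rep P b); rewrite /= ?orbT ?orbF.
apply: leq_trans (IH c).
apply: (@leq_trans (count (fun v => rep P v == c) V)); last by rewrite /=; lia.
apply: sub_count => v /=; case: (rep P v == rep P b) => //.
by rewrite eq_sym (negbTE nc).
Qed.

Definition node_pairs (nd : node) : seq (nat * nat) :=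
  match nd with
  | Bar a b | Joint a b => [:: (a, b)]
  | Virtual a b c d => [:: (a, c); (b, d)]
  | _ => [::]
  end.

Definition node_verts (nd : node) : seq (seq nat) :=
  if nd is Vertex l then [:: l] else [::].

(** Both ends of a bar lie on one strand, so a single end locates it; the first is taken, as in
    [bars]. *)
Definition node_bars (nd : node) : seq nat :=
  if nd is Bar a _ then [:: a] else [::].

(** Together with [labels], the lists [pairs], [verts] and [bar_ends] carry all that [Q] reads from
    a code. *)
Definition pairs (F : code) := flatten (map node_pairs F).
Definition verts (F : code) := flatten (map node_verts F).
Definition bar_ends (F : code) := flatten (map node_bars F).

Lemma pmap_verts (T : Type) (h : seq nat -> T) F :
  pmap (fun nd => if nd is Vertex l then Some (h l) else None) F = map h (verts F).
Proof. by rewrite /verts; elim: F => //= -[l|a b c d|a b c d|a b|a b] F /= ->. Qed.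

Lemma has_verts (p : pred (seq nat)) F :
  has (fun nd => if nd is Vertex l then p l else false) F = has p (verts F).
Proof. by rewrite /verts; elim: F => //= -[l|a b c d|a b c d|a b|a b] F /= ->. Qed.

Lemma count_bar_ends (p : pred nat) F :
  count (fun nd => if nd is Bar a _ then p a else false) F = count p (bar_ends F).
Proof. by rewrite /bar_ends; elim: F => //= -[l|a b c d|a b c d|a b|a b] F /= ->. Qed.

Lemma has_through F x y :
  has (through x y) F = ((x, y) \in pairs F) || ((y, x) \in pairs F).
Proof.
rewrite /pairs; elim: F => //= -[l|a b c d|a b c d|a b|a b] F /= -> //;
  rewrite ?inE !xpair_eqE;
  by do ![case: eqP => _ //=]; rewrite ?orbT ?orbF.
Qed.

Lemma count_ends_verts F x :
  count_mem x (ends (pairs F) ++ flatten (verts F)) <= count_mem x (labels F).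
Proof.
rewrite /ends /pairs /verts /labels /rotation.
elim: F => //= -[l|a b c d|a b c d|a b|a b] F /=; rewrite !count_cat /=; lia.
Qed.

Lemma sub_labels F x :
  x \in ends (pairs F) ++ flatten (verts F) -> x \in labels F.
Proof.
rewrite -!has_pred1 !has_count => lt0; exact: leq_trans (count_ends_verts F x).
Qed.

Lemma count_bar_labels F x : count_mem x (bar_ends F) <= count_mem x (labels F).
Proof.
rewrite /bar_ends /labels /rotation.
elim: F => //= -[l|a b c d|a b c d|a b|a b] F /=; rewrite ?count_cat /=; lia.
Qed.

Lemma pairs_labels F p : p \in pairs F -> (p.1 \in labels F) /\ (p.2 \in labels F).
Proof.
move=> pF; split; apply: sub_labels; rewrite mem_cat; apply/orP; left;
  by apply/flattenP; exists [:: p.1; p.2]; rewrite ?(map_f (fun p => [:: p.1; p.2])) // !inE eqxx ?orbT.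
Qed.

Lemma verts_labels F l x : l \in verts F -> x \in l -> x \in labels F.
Proof.
move=> lF xl; apply: sub_labels; rewrite mem_cat; apply/orP; right.
by apply/flattenP; exists l.
Qed.

Lemma wf_count F x : wf_code F -> count_mem x (labels F) <= 2.
Proof.
move=> /allP wf; have [/wf/eqP -> //|] := boolP (x \in labels F).
by rewrite -has_pred1 has_count -leqNgt leqn0 => /eqP ->.
Qed.

Section Strands.

Variable F : code.
Implicit Types x y a : nat.

Let r := rep (pairs F).

Let arc_sym : connect_sym (@arc_rel F).
Proof.
by apply: sym_connect_sym => x y; rewrite /arc_rel /= !has_through orbC.
Qed.

Lemma mem_strand (x y : arc F) : (y \in strand F (ssval x)) = connect (@arc_rel F) x y.
Proof.
rewrite inE; apply/existsP/idP => [[x' /andP[/eqP/val_inj ->]] //|c].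
by exists x; rewrite eqxx.
Qed.

Lemma strand_pair p : p \in pairs F -> strand F p.1 = strand F p.2.
Proof.
move=> pF; have [m1 m2] := pairs_labels pF.
apply/setP => z; rewrite (mem_strand (SeqSub m1)) (mem_strand (SeqSub m2)).
apply: same_connect1 => //; rewrite /arc_rel /= has_through.
by case: p pF {m1 m2} => a b ->.
Qed.

(** Equal representatives give equal strands by the universal property of [rep], since [strand F] is
    constant on pairs. Conversely, the arcs with a given representative form a set closed under
    [arc_rel]. *)
Lemma strandE x y : x \in labels F -> y \in labels F ->
  (strand F x == strand F y) = (r x == r y).
Proof.
have resp : respects (strand F) (pairs F).
  by apply/allP => p /strand_pair ->.
move=> xF yF; apply/eqP/eqP => [e|e]; last first.
  by rewrite -(respects_rep x resp) -(respects_rep y resp) -/r e.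
have : connect (@arc_rel F) (SeqSub xF) (SeqSub yF).
  by rewrite -mem_strand /= e (mem_strand (SeqSub yF)) connect0.
have cl : closed (@arc_rel F) [pred z | r (ssval z) == r x].
  move=> u v; rewrite /arc_rel /= has_through => /orP[] /rep_pair /= e2; rewrite !inE /r.
    by rewrite e2.
  by rewrite -e2.
by move=> /(closed_connect cl); rewrite !inE eqxx => /esym/eqP.
Qed.

Lemma lies_on_strand a x : x \in labels F ->
  lies_on a (strand F x) = (a \in labels F) && (r a == r x).
Proof.
move=> xF; apply/existsP/andP => [[y /andP[]]|[aF /eqP e]].
  rewrite (mem_strand (SeqSub xF)) => c /eqP <-; split; first exact: ssvalP.
  rewrite -strandE ?ssvalP //; apply/eqP/setP => z.
  by rewrite (mem_strand (SeqSub xF)) mem_strand -(same_connect arc_sym c).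
exists (SeqSub aF); rewrite /= eqxx andbT.
have /eqP <- : strand F a == strand F x by rewrite strandE // e.
by rewrite (mem_strand (SeqSub aF)).
Qed.

Lemma meets_vertex_strand x : x \in labels F ->
  meets_vertex (strand F x) = has (fun a => r a == r x) (flatten (verts F)).
Proof.
move=> xF; rewrite /meets_vertex has_verts.
apply/hasP/hasP => [[l lF /hasP[a al]]|[a /flattenP[l lF al] e]].
  rewrite lies_on_strand // => /andP[_ e]; exists a => //.
  by apply/flattenP; exists l.
exists l => //; apply/hasP; exists a => //.
by rewrite lies_on_strand // e andbT (verts_labels lF).
Qed.

Lemma bars_strand x : x \in labels F ->
  bars (strand F x) = count (fun a => r a == r x) (bar_ends F).
Proof.
move=> xF; rewrite /bars count_bar_ends; apply: eq_in_count => a aF.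
rewrite lies_on_strand //; suff -> : a \in labels F by [].
rewrite -has_pred1 has_count; apply: leq_trans (count_bar_labels F a).
by rewrite -has_count has_pred1.
Qed.

(** This supplies the hypothesis [twice] for surfaces whose bands are labelled by strands: a label
    lies in at most two places, so a strand is a path or a cycle and has at most two free ends, here
    its ends at vertices. *)
Lemma strand_twice (s : {set arc F}) : wf_code F ->
  count_mem s (flatten (map (map (strand F)) (verts F))) <= 2.
Proof.
move=> wf; rewrite -map_flatten count_map.
have [/hasP[x xV /eqP e]|] := boolP (has (fun x => strand F x == s) (flatten (verts F))); last first.
  by rewrite has_count -leqNgt leqn0 => /eqP ->.
have sub y : y \in flatten (verts F) -> y \in labels F.
  by move=> yV; apply: sub_labels; rewrite mem_cat yV orbT.
rewrite (@eq_in_count _ _ (fun y => r y == r x)).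
  apply: rep_class_count => y; apply: leq_trans (count_ends_verts F y) _.
  exact: wf_count.
by move=> y yV /=; rewrite -e strandE // sub.
Qed.

End Strands.

(** * Transport of Q along a map of labels *)

Lemma cyclic_iso_flatten (T : eqType) (V V' : seq (seq T)) :
  cyclic_iso V V' -> perm_eq (flatten V) (flatten V').
Proof.
move=> [eqs [sg [r [sgI rP]]]]; apply/permP => p.
have sgP i (iV : i < size V) : sg i < size V' by have [] := rP i iV.
pose sigma (i : 'I_(size V)) : 'I_(size V') := Ordinal (sgP i (ltn_ord i)).
have bij_sigma : bijective sigma.
  apply: inj_card_bij; last by rewrite !card_ord eqs.
  by move=> i j [/sgI e]; apply: val_inj; apply: e.
rewrite !count_flatten !sumnE !big_map !(big_nth [::]) !big_mkord.
rewrite (reindex sigma) /=; last exact: onW_bij.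
apply: eq_bigr => i _; have [_ _ ->] := rP i (ltn_ord i).
by apply/permP; rewrite perm_rot.
Qed.

Section ImsetPowerset.

Variables (T T' : finType) (h : T -> T') (A : {set T}).
Hypothesis h_inj : {in A &, injective h}.

Lemma imset_in_inj : {in powerset A &, injective (fun X : {set T} => h @: X)}.
Proof.
move=> X Y; rewrite !inE => /subsetP XA /subsetP YA e; apply/setP => x.
apply/idP/idP => xX.
  have /imsetP[t tY e'] : h x \in h @: Y by rewrite -e imset_f.
  by rewrite (h_inj (XA _ xX) (YA _ tY) e').
have /imsetP[t tX e'] : h x \in h @: X by rewrite e imset_f.
by rewrite (h_inj (YA _ xX) (XA _ tX) e').
Qed.

Lemma powerset_imset : powerset (h @: A) = [set h @: X | X : {set T} in powerset A].
Proof.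
apply/setP => Y; apply/idP/imsetP => [|[X]]; rewrite !inE; last first.
  by move=> XA ->; apply: imsetS.
move=> /subsetP YA.
exists (A :&: h @^-1: Y); first by rewrite inE subsetIl.
apply/setP => y; apply/idP/imsetP => [yY|[x]]; last by rewrite !inE => /andP[_ ?] ->.
have /imsetP[x xA e] := YA y yY; exists x => //.
by rewrite !inE xA -e.
Qed.

Lemma card_imset_if (p : pred T) (p' : pred T') :
    {in A, forall x, p' (h x) = p x} ->
  #|[set y in h @: A | p' y]| = #|[set x in A | p x]|.
Proof.
move=> pp'; rewrite -(@card_in_imset _ _ h); last first.
  by move=> x y; rewrite !inE => /andP[xA _] /andP[yA _]; apply: h_inj.
congr #|pred_of_set _|; apply/setP => y; rewrite !inE.
apply/andP/imsetP => [[/imsetP[x xA ->]]|[x]]; rewrite ?inE.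
  by rewrite pp' // => px; exists x; rewrite ?inE ?xA.
by case/andP => xA px ->; rewrite imset_f ?pp'.
Qed.

End ImsetPowerset.

Lemma strandsP F s :
  reflect (exists2 x, x \in labels F & s = strand F x) (s \in strands F).
Proof.
apply: (iffP imsetP) => [[x _ ->]|[x xF ->]]; first by exists (ssval x); rewrite ?ssvalP.
by exists (SeqSub xF).
Qed.

Section QIso.

Variables (F F' : code) (g : nat -> nat).

Local Notation r := (rep (pairs F)).
Local Notation r' := (rep (pairs F')).

Hypothesis wfF : wf_code F.
Hypothesis gL : forall x, x \in labels F -> g x \in labels F'.
(** [gE] and [gS] make [g] a bijection on strands, although [g] may identify labels, as a
    contraction does. *)
Hypothesis gE : {in labels F &, forall x y, (r' (g x) == r' (g y)) = (r x == r y)}.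
Hypothesis gS : forall u, u \in labels F' -> exists2 x, x \in labels F & r' (g x) = r' u.
Hypothesis gV : cyclic_iso (map (map g) (verts F)) (verts F').
Hypothesis gB : forall x, x \in labels F ->
  odd (count (fun a => r' a == r' (g x)) (bar_ends F')) =
  odd (count (fun a => r a == r x) (bar_ends F)).

(** By [gE] the result does not depend on the label picked; the default [set0] is never reached on a
    strand. *)
Let fs (s : {set arc F}) : {set arc F'} :=
  if [pick x : arc F | strand F (ssval x) == s] is Some x
  then strand F' (g (ssval x)) else set0.

Let fsE x : x \in labels F -> fs (strand F x) = strand F' (g x).
Proof.
move=> xF; rewrite /fs; case: pickP => [y|/(_ (SeqSub xF))]; last by rewrite eqxx.
rewrite strandE ?ssvalP // => e; apply/eqP.
by rewrite strandE ?gL ?ssvalP // gE ?ssvalP.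
Qed.

Let fs_inj : {in strands F &, injective fs}.
Proof.
move=> s t /strandsP[x xF ->] /strandsP[y yF ->]; rewrite !fsE // => /eqP.
by rewrite strandE ?gL // gE // -strandE // => /eqP.
Qed.

Let strands_iso : strands F' = fs @: strands F.
Proof.
apply/setP => t; apply/strandsP/imsetP => [[u uF' ->]|[s /strandsP[x xF ->] ->]].
  have [x xF e] := gS uF'; exists (strand F x); first by apply/strandsP; exists x.
  by rewrite fsE //; apply/eqP; rewrite strandE ?gL // e.
by exists (g x); rewrite ?gL // fsE.
Qed.

Let vert_label x : x \in flatten (verts F) -> x \in labels F.
Proof. by case/flattenP => l lF; apply: verts_labels. Qed.

Let meets_iso s : s \in strands F -> meets_vertex (fs s) = meets_vertex s.
Proof.
case/strandsP => x xF ->; rewrite fsE // !meets_vertex_strand ?gL //.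
rewrite -(perm_has _ (cyclic_iso_flatten gV)) -map_flatten has_map.
by apply: eq_in_has => a /vert_label aF /=; rewrite gE.
Qed.

Let odd_bars s : s \in strands F -> odd (bars (fs s)) = odd (bars s).
Proof.
by case/strandsP => x xF ->; rewrite fsE // !bars_strand ?gL // gB.
Qed.

Let sub_iso (p : pred {set arc F}) (p' : pred {set arc F'}) :
    {in strands F, forall s, p' (fs s) = p s} ->
  [set t in strands F' | p' t] = fs @: [set s in strands F | p s].
Proof.
move=> pp'; rewrite strands_iso; apply/setP => t; rewrite !inE.
apply/andP/imsetP => [[/imsetP[s sF ->]]|[s]]; rewrite ?inE.
  by rewrite pp' // => ps; exists s; rewrite ?inE ?sF.
by case/andP => sF ps ->; rewrite imset_f ?pp'.
Qed.

Let edges_iso : edges F' = fs @: edges F.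
Proof. by apply: sub_iso => s sF; apply: meets_iso. Qed.

Let circles_iso : circles F' = fs @: circles F.
Proof. by apply: sub_iso => s sF; rewrite meets_iso. Qed.

Let edges_sub s : s \in edges F -> s \in strands F.
Proof. by rewrite inE => /andP[]. Qed.

Let circles_sub s : s \in circles F -> s \in strands F.
Proof. by rewrite inE => /andP[]. Qed.

Variables (K : comNzRingType) (y z w : K).

Let M_iso (X : {set {set arc F}}) : X \subset edges F ->
  M y z w (fs @: X) = M y z w X.
Proof.
move=> /subsetP XE; rewrite /M /pure_surface !pmap_verts.
set W := [seq _ | l <- verts F]; set W' := [seq _ | l <- verts F'].
have WE : W = map (filter [in X]) (map (map (strand F)) (verts F)).
  by rewrite -map_comp.
have flatW : {subset flatten W <= edges F}.
  by move=> s; rewrite WE -filter_flatten mem_filter => /andP[/XE].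
have [] := @disk_band_cyclic_iso _ _ W W' (fun s => odd (bars s)) (fun s => odd (bars s)) fs.
- move=> s; rewrite WE -filter_flatten count_filter.
  apply: leq_trans (strand_twice s wfF); apply: sub_count => t /=.
  by case/andP.
- by move=> s t /flatW/edges_sub sF /flatW/edges_sub; apply: fs_inj.
- by move=> s /flatW/edges_sub; apply: odd_bars.
- have -> : W' = map (filter [in fs @: X]) (map (map (strand F')) (verts F')).
    by rewrite -map_comp.
  have -> : map (map fs) W =
      map (filter [in fs @: X]) (map (map (strand F')) (map (map g) (verts F))).
    rewrite -!map_comp; apply/eq_in_map => l lF /=.
    have {lF} : {subset l <= labels F} by move=> x; apply: verts_labels.
    elim: l => //= x l IH lF; have xF : x \in labels F by apply: lF; rewrite mem_head.
    rewrite -IH; last by move=> a al; apply: lF; rewrite inE al orbT.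
    (* Since [fs] is injective on strands, a band survives on one side exactly when it survives on
       the other, so [map fs] commutes with filtering. *)
    have -> : (strand F' (g x) \in fs @: X) = (strand F x \in X).
      rewrite -fsE //; apply/imsetP/idP => [[s sX /fs_inj -> //]|]; last by exists (strand F x).
        by apply/strandsP; exists x.
      exact/edges_sub/XE.
    by case: ifP => //=; rewrite fsE.
  exact/cyclic_iso_filter/cyclic_iso_map.
by move=> -> -> -> ->.
Qed.

Theorem Q_iso : Q F y z w = Q F' y z w.
Proof.
have circ_inj : {in circles F &, injective fs}.
  by move=> s t /circles_sub sF /circles_sub; apply: fs_inj.
have edge_inj : {in edges F &, injective fs}.
  by move=> s t /edges_sub sF /edges_sub; apply: fs_inj.
rewrite /Q edges_iso circles_iso powerset_imset big_imset; last exact: imset_in_inj.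
rewrite (card_imset_if circ_inj (p := fun s => odd (bars s)) (p' := fun s => odd (bars s))); last first.
  by move=> s /circles_sub; apply: odd_bars.
rewrite (card_imset_if circ_inj (p := fun s => ~~ odd (bars s)) (p' := fun s => ~~ odd (bars s))); last first.
  by move=> s /circles_sub /odd_bars ->.
congr (_ * _)%R; apply: eq_bigr => X; rewrite inE => XE.
by rewrite M_iso.
Qed.

End QIso.

(** * Elementary changes of a code that preserve Q *)

Lemma wf_codeP F :
  reflect (forall x, x \in labels F -> count_mem x (labels F) = 2) (wf_code F).
Proof. by apply: (iffP allP) => wf x /wf /eqP. Qed.

Lemma wf_perm F F' : perm_eq (labels F) (labels F') -> wf_code F = wf_code F'.
Proof.
move=> pF; rewrite /wf_code (perm_all _ pF); apply: eq_all => x.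
by rewrite (permP pF).
Qed.

Lemma labels_cat F G : labels (F ++ G) = labels F ++ labels G.
Proof. by rewrite /labels /rotation map_cat flatten_cat. Qed.

Lemma pairs_cat F G : pairs (F ++ G) = pairs F ++ pairs G.
Proof. by rewrite /pairs map_cat flatten_cat. Qed.

Lemma verts_cat F G : verts (F ++ G) = verts F ++ verts G.
Proof. by rewrite /verts map_cat flatten_cat. Qed.

Lemma bar_ends_cat F G : bar_ends (F ++ G) = bar_ends F ++ bar_ends G.
Proof. by rewrite /bar_ends map_cat flatten_cat. Qed.

Lemma respects_cat (k : nat -> nat) P1 P2 :
  respects k (P1 ++ P2) = respects k P1 && respects k P2.
Proof. exact: all_cat. Qed.

Section Relabel.

Variable f : nat -> nat.

Lemma labels_relabel F : labels (relabel f F) = map f (labels F).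
Proof.
by rewrite /labels /rotation; elim: F => //= -[l|a b c d|a b c d|a b|a b] F /= ->; rewrite ?map_cat.
Qed.

Lemma pairs_relabel F : pairs (relabel f F) = [seq (f p.1, f p.2) | p <- pairs F].
Proof. by rewrite /pairs; elim: F => //= -[l|a b c d|a b c d|a b|a b] F /= ->. Qed.

Lemma verts_relabel F : verts (relabel f F) = map (map f) (verts F).
Proof. by rewrite /verts; elim: F => //= -[l|a b c d|a b c d|a b|a b] F /= ->. Qed.

Lemma bar_ends_relabel F : bar_ends (relabel f F) = map f (bar_ends F).
Proof. by rewrite /bar_ends; elim: F => //= -[l|a b c d|a b c d|a b|a b] F /= ->. Qed.

Lemma relabel_cat F G : relabel f (F ++ G) = relabel f F ++ relabel f G.
Proof. exact: map_cat. Qed.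

Lemma relabel_id F : {in labels F, forall x, f x = x} -> relabel f F = F.
Proof.
elim: F => //= nd F IH fid; rewrite IH; last first.
  by move=> x xF; apply: fid; rewrite /labels /= mem_cat [X in _ || X]xF orbT.
congr (_ :: _); have {}fid : {in ports nd, forall x, f x = x}.
  by move=> x xn; apply: fid; rewrite /labels /= mem_cat xn.
case: nd fid => [l|a b c d|a b c d|a b|a b] fid /=.
- by congr Vertex; rewrite -[RHS]map_id; apply/eq_in_map.
- by rewrite !fid ?inE ?eqxx ?orbT.
- by rewrite !fid ?inE ?eqxx ?orbT.
- by rewrite !fid ?inE ?eqxx ?orbT.
- by rewrite !fid ?inE ?eqxx ?orbT.
Qed.

Lemma wf_relabel F : injective f -> wf_code (relabel f F) = wf_code F.
Proof.
move=> f_inj; rewrite /wf_code labels_relabel all_map; apply: eq_all => x /=.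
by rewrite count_map; congr (_ == 2); apply: eq_count => y /=; rewrite (inj_eq f_inj).
Qed.

End Relabel.

Lemma rep_relabel f P x : injective f ->
  rep [seq (f p.1, f p.2) | p <- P] (f x) = f (rep P x).
Proof.
move=> f_inj; elim: P x => //= p P IH x.
by rewrite !IH (inj_eq f_inj); case: ifP.
Qed.

Definition contraction (x y l : nat) : nat := if l == y then x else l.

(** The joint uses one occurrence of each of [x] and [y], so each is left once in [E] and the merged
    label occurs twice. *)
Lemma wf_contract x y E : wf_code (Joint x y :: E) -> x != y ->
  wf_code (relabel (contraction x y) E).
Proof.
set L := labels E => /wf_codeP wf xy; apply/wf_codeP => u.
have cnt v : v \in [:: x, y & L] -> (x == v) + ((y == v) + count_mem v L) = 2 by apply: wf.
have cx : count_mem x L = 1.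
  by have := cnt x; rewrite !inE !eqxx (eq_sym y x) (negbTE xy) => /(_ isT); lia.
have cy : count_mem y L = 1.
  by have := cnt y; rewrite !inE !eqxx orbT (negbTE xy) => /(_ isT); lia.
have cxy : count (fun l => contraction x y l == x) L = 2.
  have := count_predUI (pred1 x) (pred1 y) L; rewrite cx cy.
  rewrite (@eq_count _ (predI _ _) pred0) ?count_pred0 ?addn0 => [e|l /=]; last first.
    by have [->|] := eqVneq l x; rewrite ?(negbTE xy).
  rewrite -[RHS]/(1 + 1) -e; apply: eq_count => l; rewrite /contraction /=.
  by have [->|] := eqVneq l y; rewrite ?eqxx ?orbT ?orbF.
rewrite labels_relabel -/L count_map => /mapP[v vL ->].
rewrite {2}/contraction; have [_|vy] := eqVneq v y; first exact: cxy.
have [->|vx] := eqVneq v x; first exact: cxy.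
have <- := cnt v; last by rewrite !inE vL !orbT.
rewrite eq_sym (negbTE vx) eq_sym (negbTE vy) !add0n.
apply: eq_count => l; rewrite /contraction /=; have [->|//] := eqVneq l y.
by rewrite eq_sym (negbTE vx) eq_sym (negbTE vy).
Qed.

Section QSteps.

Variables (K : comNzRingType) (y z w : K).

(** Well-formedness is carried along so that a chain of steps needs it only for its first code. *)
Definition Q_step F F' : Prop :=
  wf_code F -> wf_code F' /\ Q F y z w = Q F' y z w.

Lemma Q_step_trans F G H : Q_step F G -> Q_step G H -> Q_step F H.
Proof. by move=> FG GH /FG[/GH[wH <-]]. Qed.

(** Being respected by the same functions means generating the same equivalence relation, whatever
    the order and direction of the pairs; it is applied with [k] the [rep] of either code. Bars are
    compared after such a [k] because a bar may be recorded by either end. *)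
Lemma Q_step_equiv F F' :
    perm_eq (labels F) (labels F') ->
    (forall k : nat -> nat, respects k (pairs F) = respects k (pairs F')) ->
    cyclic_iso (verts F) (verts F') ->
    (forall k : nat -> nat, respects k (pairs F) ->
       perm_eq (map k (bar_ends F)) (map k (bar_ends F'))) ->
  Q_step F F'.
Proof.
move=> pl pp pv pb wF; split; first by rewrite -(wf_perm pl).
have repE a b : (rep (pairs F') a == rep (pairs F') b) = (rep (pairs F) a == rep (pairs F) b).
  have r1 : respects (rep (pairs F')) (pairs F) by rewrite pp rep_respects.
  have r2 : respects (rep (pairs F)) (pairs F') by rewrite -pp rep_respects.
  apply/eqP/eqP => e.
    by rewrite -(respects_rep a r2) e respects_rep.
  by rewrite -(respects_rep a r1) e respects_rep.
apply: (Q_iso (g := id)) => //.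
- by move=> x; rewrite (perm_mem pl).
- by move=> u; rewrite -(perm_mem pl) => uF; exists u.
- by rewrite (eq_map (@map_id nat)) map_id.
move=> x _; congr odd; under eq_count do rewrite repE.
have /permP/(_ (pred1 (rep (pairs F) x))) := pb _ (rep_respects (pairs F)).
by rewrite !count_map.
Qed.

Lemma Q_step_perm F F' :
    perm_eq (labels F) (labels F') -> perm_eq (pairs F) (pairs F') ->
    perm_eq (verts F) (verts F') -> perm_eq (bar_ends F) (bar_ends F') ->
  Q_step F F'.
Proof.
move=> pl pp pv pb; apply: Q_step_equiv => // [k||k _].
- exact: perm_all.
- exact: cyclic_iso_perm.
- exact: perm_map.
Qed.

Lemma Q_step_relabel f F : injective f -> Q_step F (relabel f F).
Proof.
move=> f_inj wF; split; first by rewrite wf_relabel.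
have repE x : rep (pairs (relabel f F)) (f x) = f (rep (pairs F) x).
  by rewrite pairs_relabel rep_relabel.
apply: (Q_iso (g := f)) => //.
- by move=> x xF; rewrite labels_relabel map_f.
- by move=> a b _ _; rewrite !repE (inj_eq f_inj).
- by move=> u; rewrite labels_relabel => /mapP[x xF ->]; exists x.
- by rewrite verts_relabel; apply: cyclic_iso_perm.
move=> x _; rewrite bar_ends_relabel count_map; congr odd.
by apply: eq_count => a /=; rewrite !repE (inj_eq f_inj).
Qed.

(** The condition [x != x'] excludes a closed joint: that would be a circle component, and
    contracting it would lose a factor of [Q]. The classes agree because [rep] of either code,
    composed with the contraction where needed, respects the pairs of the other. *)
Lemma Q_step_contract x x' F : x != x' ->
  Q_step (Joint x x' :: F) (relabel (contraction x x') F).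
Proof.
move=> xx' wF; split; first exact: wf_contract.
set c := contraction x x'; set E := Joint x x' :: F.
have cx : c x = x by rewrite /c /contraction (negbTE xx').
have cx' : c x' = x by rewrite /c /contraction eqxx.
have memL u : u \in labels F -> c u \in labels (relabel c F).
  by move=> uF; rewrite labels_relabel map_f.
(* [x'] occurs twice in all and once in the joint, so its image [x] is a label of the contracted
   code. *)
have x'F : x' \in labels F.
  have /wf_codeP/(_ x') := wF; rewrite -[labels _]/[:: x, x' & labels F] /= !inE !eqxx orbT.
  by rewrite (negbTE xx') -has_pred1 has_count => /(_ isT) [c1]; rewrite -[X in _ < X]add0n c1.
have repE a b : (rep (pairs (relabel c F)) (c a) == rep (pairs (relabel c F)) (c b)) =
                (rep (pairs E) a == rep (pairs E) b).
  rewrite pairs_relabel; set P := map _ _.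
  have r1 : respects (fun u => rep P (c u)) (pairs E).
    apply/allP => p; rewrite inE => /predU1P[->|pF] /=; first by rewrite cx cx'.
    by apply/eqP/(rep_pair (p := (c p.1, c p.2)))/mapP; exists p.
  have repc u : rep (pairs E) (c u) = rep (pairs E) u.
    rewrite /c /contraction; case: eqP => // ->.
    by apply: (rep_pair (p := (x, x'))); rewrite inE eqxx.
  have r2 : respects (rep (pairs E)) P.
    apply/allP => _ /mapP[p pF ->]; apply/eqP.
    change (rep (pairs E) (c p.1) = rep (pairs E) (c p.2)); rewrite !repc.
    by apply: rep_pair; rewrite inE pF orbT.
  apply/eqP/eqP => e.
    by rewrite -(repc a) -(respects_rep (c a) r2) e respects_rep.
  have r1E u : rep P (c (rep (pairs E) u)) = rep P (c u) := respects_rep u r1.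
  by rewrite -(r1E a) e r1E.
apply: (Q_iso (g := c)) => //.
- move=> u; rewrite -[labels _]/[:: x, x' & labels F] !inE.
  by have := memL _ x'F; rewrite cx' => xL /or3P[/eqP ->|/eqP ->|/memL]; rewrite ?cx ?cx'.
- move=> u; rewrite labels_relabel => /mapP[v vF ->]; exists v => //.
  by rewrite -[labels _]/[:: x, x' & labels F] !inE vF !orbT.
- by rewrite verts_relabel; apply: cyclic_iso_perm.
move=> u _; rewrite bar_ends_relabel count_map; congr odd.
by apply: eq_count => a /=; rewrite repE.
Qed.

End QSteps.

(** Permutations of partly explicit codes are proved by counting an arbitrary predicate on both
    sides. *)
Ltac code_perm :=
  apply/permP => ?;
  rewrite /labels /pairs /verts /bar_ends /rotation /= ?map_cat ?flatten_cat /=;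
  rewrite ?map_cat ?flatten_cat /= ?count_cat /= ?count_cat /=; lia.

Section Contractions.

Variables (K : comNzRingType) (y z w : K).
Local Notation Q_step := (Q_step y z w).

Lemma contraction_id a b l : l != b -> contraction a b l = l.
Proof. by rewrite /contraction => /negbTE ->. Qed.

(** The two joints already use both occurrences of [m], so [m] differs from [a] and [b] and is
    absent from [F]: contracting the first joint rewrites only the second. The same freshness
    argument absorbs a joint into a vertex or into a strand below. *)
Lemma Q_step_join a m b F :
  Q_step (Joint a m :: Joint m b :: F) (Joint a b :: F).
Proof.
move=> wF; have cm := wf_count m wF.
rewrite -[labels _]/[:: a, m, m, b & labels F] /= !eqxx in cm.
have am : a != m by apply/eqP => e; move: cm; rewrite e eqxx.
have bm : b != m by apply/eqP => e; move: cm; rewrite e eqxx; case: (a == m).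
have mF : m \notin labels F.
  by rewrite -has_pred1 has_count; case: (a == m) (b == m) cm => [] [] /=; case: count.
have -> : Joint a b :: F = relabel (contraction a m) (Joint m b :: F).
  rewrite /= (contraction_id a bm) {1}/contraction eqxx relabel_id // => l lF.
  by apply: contraction_id; apply: contraNneq mF => <-.
exact: Q_step_contract.
Qed.

Lemma Q_step_leg a m v1 v2 F :
  Q_step (Joint a m :: Vertex (v1 ++ m :: v2) :: F) (Vertex (v1 ++ a :: v2) :: F).
Proof.
move=> wF; have cm := wf_count m wF.
have le2 : (a == m) + 1 + 1 + count_mem m v1 + count_mem m v2 + count_mem m (labels F) <= 2.
  move: cm; rewrite -[labels _]/(a :: m :: (v1 ++ m :: v2) ++ labels F) /= !count_cat /= !eqxx.
  by rewrite /=; lia.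
have am : a != m by apply/eqP => e; move: le2; rewrite e eqxx.
have fresh s : count_mem m s <= 0 -> {in s, contraction a m =1 id}.
  move=> c0 l ls; apply: contraction_id; apply: contraTneq c0 => <-.
  by rewrite -ltnNge -has_count has_pred1.
have -> : Vertex (v1 ++ a :: v2) :: F = relabel (contraction a m) (Vertex (v1 ++ m :: v2) :: F).
  rewrite /= map_cat /= {2}/contraction eqxx relabel_id; last by apply: fresh; lia.
  by rewrite !map_id_in //; apply: fresh; lia.
exact: Q_step_contract.
Qed.

Lemma Q_step_strand a m us q F :
  Q_step (Joint a m :: virtual_strand m us q ++ F) (virtual_strand a us q ++ F).
Proof.
move=> wF; have cm := wf_count m wF.
case: us wF cm => [|[[x x'] s] us] wF; first by move=> _; apply: Q_step_join.
set V := virtual_strand s us q ++ F.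
rewrite -[labels _]/[:: a, m, m, x, s, x' & labels V] /= !eqxx /= => cm.
have le2 : (a == m) + 1 + 1 + (x == m) + (s == m) + (x' == m) + count_mem m (labels V) <= 2.
  by move: cm; rewrite -!addnA.
have am : a != m by apply/eqP => e; move: le2; rewrite e eqxx; lia.
have fresh u : (u == m) <= 0 -> contraction a m u = u.
  by case: eqP => // /eqP um _; apply: contraction_id.
have -> : [:: Virtual a x s x' & V] = relabel (contraction a m) [:: Virtual m x s x' & V].
  rewrite /= {1}/contraction eqxx !fresh ?relabel_id //; try lia.
  move=> l lV; apply: contraction_id; apply: contraTneq le2 => <-.
  by rewrite -ltnNge; have : 0 < count_mem l (labels V); [rewrite -has_count has_pred1|lia].
exact: Q_step_contract.
Qed.

End Contractions.

(** * The virtual moves on pure diagrams *)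

Section QMoves.

Variables (K : comNzRingType) (y z w : K).
Local Notation Q_step := (Q_step y z w).

Lemma Q_step_I F a b m :
  Q_step (F ++ [:: Virtual a m m b]) (F ++ [:: Joint a b]).
Proof.
apply: (@Q_step_trans _ _ _ _ _ (Joint a m :: Joint m b :: F)).
  by apply: Q_step_perm; code_perm.
apply: Q_step_trans; first exact: Q_step_join.
by apply: Q_step_perm; code_perm.
Qed.

Lemma Q_step_II F b1 b2 t1 t2 l r :
  Q_step (F ++ [:: Virtual b1 b2 r l; Virtual l r t2 t1])
         (F ++ [:: Joint b1 t1; Joint b2 t2]).
Proof.
apply: (@Q_step_trans _ _ _ _ _ (Joint b1 r :: Joint r t1 :: F ++ [:: Joint b2 l; Joint l t2])).
  by apply: Q_step_perm; code_perm.
apply: Q_step_trans; first exact: Q_step_join.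
apply: (@Q_step_trans _ _ _ _ _ (Joint b2 l :: Joint l t2 :: F ++ [:: Joint b1 t1])).
  by apply: Q_step_perm; code_perm.
apply: Q_step_trans; first exact: Q_step_join.
by apply: Q_step_perm; code_perm.
Qed.

(** Either side of the triangle move splits into six such joints, since on both sides the strand
    from [p1] to [p4] passes through [u1], and likewise for the other two. *)
Lemma Q_step_three_joins F a1 m1 b1 a2 m2 b2 a3 m3 b3 :
  Q_step (F ++ [:: Joint a1 m1; Joint m1 b1; Joint a2 m2; Joint m2 b2;
                   Joint a3 m3; Joint m3 b3])
         (F ++ [:: Joint a1 b1; Joint a2 b2; Joint a3 b3]).
Proof.
apply: (@Q_step_trans _ _ _ _ _ (Joint a1 m1 :: Joint m1 b1 ::
    F ++ [:: Joint a2 m2; Joint m2 b2; Joint a3 m3; Joint m3 b3])).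
  by apply: Q_step_perm; code_perm.
apply: Q_step_trans; first exact: Q_step_join.
apply: (@Q_step_trans _ _ _ _ _ (Joint a2 m2 :: Joint m2 b2 ::
    F ++ [:: Joint a1 b1; Joint a3 m3; Joint m3 b3])).
  by apply: Q_step_perm; code_perm.
apply: Q_step_trans; first exact: Q_step_join.
apply: (@Q_step_trans _ _ _ _ _ (Joint a3 m3 :: Joint m3 b3 ::
    F ++ [:: Joint a1 b1; Joint a2 b2])).
  by apply: Q_step_perm; code_perm.
apply: Q_step_trans; first exact: Q_step_join.
by apply: Q_step_perm; code_perm.
Qed.

(** The crossing [Virtual p x s x'] amounts to joints [p s] and [x x']. The first is absorbed by the
    rest of the strand, the second by the vertex, where [x] replaces [x']. In the induction [v1]
    collects the legs already treated. *)
Lemma Q_step_IV F v1 v2 p us q :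
  Q_step (F ++ Vertex (v1 ++ map inner_part us ++ v2) :: virtual_strand p us q)
         (F ++ [:: Vertex (v1 ++ map outer_part us ++ v2); Joint p q]).
Proof.
elim: us v1 p => [|[[x x'] s] us IH] v1 p; first by move=> wF.
rewrite [map _ _]/= [virtual_strand _ _ _]/= [X in _ ++ [:: Vertex (_ ++ X ++ _); _]]/=.
rewrite !cat_cons -[inner_part _]/x' -[outer_part _]/x.
have [v vE] : {v | v = map inner_part us ++ v2} by eexists.
rewrite -vE.
apply: (@Q_step_trans _ _ _ _ _ (Joint p s :: virtual_strand s us q ++
    Joint x x' :: Vertex (v1 ++ x' :: v) :: F)).
  by apply: Q_step_perm; code_perm.
apply: Q_step_trans; first exact: Q_step_strand.
apply: (@Q_step_trans _ _ _ _ _ (Joint x x' :: Vertex (v1 ++ x' :: v) ::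
    virtual_strand p us q ++ F)).
  by apply: Q_step_perm; code_perm.
apply: Q_step_trans; first exact: Q_step_leg.
rewrite vE -2!(cat_rcons x v1); apply: Q_step_trans; last exact: IH.
by apply: Q_step_perm; code_perm.
Qed.

(** Vertices are compared inside arbitrary surroundings because [cyclic_iso] refers to positions in
    the whole list. *)
Definition same_piece (A B : code) : Prop :=
  [/\ perm_eq (labels A) (labels B),
      forall k : nat -> nat, respects k (pairs A) = respects k (pairs B),
      forall V1 V2, cyclic_iso (V1 ++ verts A ++ V2) (V1 ++ verts B ++ V2)
    & forall k : nat -> nat, respects k (pairs A) ->
        map k (bar_ends A) = map k (bar_ends B)].

Lemma Q_step_piece A B F G :
  same_piece A B -> Q_step (F ++ A ++ G) (F ++ B ++ G).
Proof.
case=> pl pp pv pb; apply: Q_step_equiv => [|k||k].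
- by rewrite !labels_cat perm_cat2l perm_cat2r.
- by rewrite !pairs_cat !respects_cat pp.
- by rewrite !verts_cat.
rewrite !pairs_cat !respects_cat => /and3P[_ kA _].
by rewrite !bar_ends_cat !map_cat (pb _ kA).
Qed.

Lemma same_piece_eq_verts A B :
    perm_eq (labels A) (labels B) ->
    (forall k : nat -> nat, respects k (pairs A) = respects k (pairs B)) ->
    verts A = verts B ->
    (forall k : nat -> nat, respects k (pairs A) ->
        map k (bar_ends A) = map k (bar_ends B)) ->
  same_piece A B.
Proof. by move=> pl pp pv pb; split=> // V1 V2; rewrite pv; apply: cyclic_iso_perm. Qed.

Lemma same_piece_rot n s : same_piece [:: Vertex (rot n s)] [:: Vertex s].
Proof.
split=> // [|V1 V2]; last exact: cyclic_iso_rot.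
by rewrite /labels /= !cats0 perm_rot.
Qed.

Lemma same_piece_node m n : same_node m n -> ~~ is_classical m -> same_piece [:: n] [:: m].
Proof.
case=> [k s|a b c d|a b c d|a b|a b] // _; first exact: same_piece_rot.
- apply: same_piece_eq_verts => // [|k]; first by code_perm.
  by rewrite /= !andbT (eq_sym (k c)) andbC.
- apply: same_piece_eq_verts => // [|k|k]; first by code_perm.
    by rewrite /= eq_sym.
  by rewrite /= andbT => /eqP ->.
- apply: same_piece_eq_verts => // [|k]; first by code_perm.
  by rewrite /= eq_sym.
Qed.

(** A half turn of the crossing exchanges the two arcs of the smoothings of spin +1 and -1, and
    rotates the vertex of spin 0 by two places. *)
Lemma same_piece_smooth s a b c d :
  same_piece (smooth s c d a b) (smooth s a b c d).
Proof.
case: s => [[]|].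
- apply: same_piece_eq_verts => // [|k]; first by code_perm.
  by rewrite /= !andbT (eq_sym (k c)) (eq_sym (k d)) andbC.
- apply: same_piece_eq_verts => // [|k]; first by code_perm.
  by rewrite /= !andbT (eq_sym (k c)) (eq_sym (k b)) andbC.
- exact: (same_piece_rot 2 [:: a; b; c; d]).
Qed.

End QMoves.

(** * Recursive expansion of R over the states *)

Section StateSum.

Variables (L : comNzRingType) (u : spin -> L).
Local Open Scope ring_scope.

Definition node_sum (nd : node) (P : code -> L) : L :=
  if nd is Classical a b c d then \sum_(s : spin) u s * P (smooth s a b c d)
  else P [:: nd].

(** The tuples summed over in [R] have a length that depends on the code, which hinders changing the
    code locally. Here [P] acts as a continuation receiving the resolved code, so that one piece can
    be expanded while the rest is fixed. *)
Fixpoint state_sum (E : code) (P : code -> L) : L :=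
  if E is nd :: E' then
    node_sum nd (fun A => state_sum E' (fun F => P (A ++ F)))
  else P [::].

Lemma eq_node_sum nd P P' :
    (forall A, perm_eq (labels A) (ports nd) -> P A = P' A) ->
  node_sum nd P = node_sum nd P'.
Proof.
case: nd => [l|a b c d|a b c d|a b|a b] PP' /=; try by apply: PP'; rewrite /labels /= ?cats0.
apply: eq_bigr => s _; congr (_ * _); apply: PP'.
by case: s => [[]|] /=; code_perm.
Qed.

(** The restriction to permuted labels is what transfers well-formedness from a code to its states,
    where [Q_step] requires it. *)
Lemma eq_state_sum E P P' :
    (forall F, perm_eq (labels F) (labels E) -> P F = P' F) ->
  state_sum E P = state_sum E P'.
Proof.
elim: E P P' => [|nd E IH] P P' PP' /=; first exact: PP'.
apply: eq_node_sum => A pA; apply: IH => F pF; apply: PP'.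
by rewrite labels_cat; apply: perm_cat.
Qed.

Lemma state_sum_cat E1 E2 P :
  state_sum (E1 ++ E2) P = state_sum E1 (fun F => state_sum E2 (fun G => P (F ++ G))).
Proof.
elim: E1 P => //= nd E1 IH P; apply: eq_node_sum => A _; rewrite IH.
by apply: eq_state_sum => F _; apply: eq_state_sum => G _; rewrite catA.
Qed.

Lemma node_sum_pure nd P : ~~ is_classical nd -> node_sum nd P = P [:: nd].
Proof. by case: nd. Qed.

Lemma state_sum_pure E P : ~~ has is_classical E -> state_sum E P = P E.
Proof.
elim: E P => // nd E IH P; rewrite [has _ _]/= negb_or => /andP[nc /IH cE].
by rewrite /= node_sum_pure // cE.
Qed.

Lemma node_sum_swap m n (G : code -> code -> L) :
  node_sum m (fun A => node_sum n (G A)) = node_sum n (fun B => node_sum m (G^~ B)).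
Proof.
case: m => [l|a b c d|a b c d|a b|a b]; case: n => //= a' b' c' d'.
under eq_bigr do rewrite mulr_sumr; rewrite exchange_big /=.
by apply: eq_bigr => s _; rewrite mulr_sumr; apply: eq_bigr => t _; rewrite mulrCA.
Qed.

Lemma state_sum_relabel f E P :
  state_sum (relabel f E) P = state_sum E (fun F => P (relabel f F)).
Proof.
elim: E P => //= nd E IH P.
have relE A : state_sum (relabel f E) (fun F => P (relabel f A ++ F)) =
    state_sum E (fun F => P (relabel f (A ++ F))).
  by rewrite IH; apply: eq_state_sum => F _; rewrite relabel_cat.
case: nd => [l|a b c d|a b c d|a b|a b] /=.
- exact: (relE [:: Vertex l]).
- apply: eq_bigr => s _; rewrite -relE.
  by have -> : smooth s (f a) (f b) (f c) (f d) = relabel f (smooth s a b c d)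
    by case: s => [[]|].
- exact: (relE [:: Virtual a b c d]).
- exact: (relE [:: Bar a b]).
- exact: (relE [:: Joint a b]).
Qed.

End StateSum.

Lemma big_tupleS (L : nmodType) (T : finType) n (G : n.+1.-tuple T -> L) :
  (\sum_(t : n.+1.-tuple T) G t = \sum_(x : T) \sum_(t : n.-tuple T) G [tuple of x :: t])%R.
Proof.
rewrite pair_bigA /= (reindex (fun p : T * n.-tuple T => [tuple of p.1 :: p.2])) //=.
exists (fun t => (thead t, [tuple of behead t])) => [[x t] _|t _] /=.
  by congr pair; apply: val_inj.
by rewrite -tuple_eta.
Qed.

Section StateWeights.

Local Open Scope ring_scope.

Let writhe (s : seq spin) : int :=
  (count_mem (Some true) s)%:Z - (count_mem (Some false) s)%:Z.

Definition spin_weight (s : spin) : Rring := qpolyC idem_poly (aK ^ writhe [:: s]).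

Let aK_neq0 : aK != 0.
Proof. by rewrite tofrac_eq0 polyX_eq0. Qed.

Let weight_cons s t :
  qpolyC idem_poly (aK ^ writhe (s :: t)) = spin_weight s * qpolyC idem_poly (aK ^ writhe t).
Proof.
rewrite /spin_weight -qpolyCM -expfzDr //; congr (qpolyC _ (_ ^ _)).
by rewrite /writhe /= !addn0 !PoszD; ring.
Qed.

Lemma sum_states E (P : code -> Rring) :
  \sum_(s : (count is_classical E).-tuple spin)
    qpolyC idem_poly (aK ^ writhe s) * P (state E s) = state_sum spin_weight E P.
Proof.
elim: E P => [|nd E IH] P.
  rewrite (big_pred1 [tuple]) => [|t]; last by apply/esym/eqP; rewrite (tuple0 t).
  by rewrite /= /writhe /= subrr expr0z mul1r.
case: nd => [l|a b c d|a b c d|p q|p q]; rewrite [RHS]/= -?IH //.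
rewrite big_tupleS; apply: eq_bigr => s _; rewrite -IH mulr_sumr.
by apply: eq_bigr => t _; rewrite weight_cons mulrA.
Qed.

Lemma R_state_sum E :
  R E = state_sum spin_weight E (fun F => Q F (qpolyC idem_poly (- aK - 2 - aK^-1))
                                        (qpolyC idem_poly zK) (qpolyX idem_poly)).
Proof. exact: sum_states. Qed.

End StateWeights.

(** * Invariance under recoding and under the virtual moves *)

Section Invariance.

Variables (L : comNzRingType) (u : spin -> L) (y z w : L).

Let RQ E := state_sum u E (fun F => Q F y z w).

(** [X] and [Y] have no crossing to resolve, so both expansions run over the states of [T] with the
    same weights, and the step applies to each state. *)
Let RQ_step T X Y :
    ~~ has is_classical X -> ~~ has is_classical Y ->
    (forall F, Q_step y z w (F ++ X) (F ++ Y)) ->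
  wf_code (T ++ X) -> RQ (T ++ X) = RQ (T ++ Y).
Proof.
move=> pX pY XY wT; rewrite /RQ !state_sum_cat; apply: eq_state_sum => F pF.
rewrite !state_sum_pure //; apply: (proj2 (XY F _)).
by rewrite (wf_perm (F' := T ++ X)) // !labels_cat perm_cat2r.
Qed.

Lemma labels_same_node m n : same_node m n -> perm_eq (ports n) (ports m).
Proof.
case=> [k s|a b c d|a b c d|a b|a b] /=; rewrite ?perm_rot //;
  by apply/permP => p /=; lia.
Qed.

Lemma same_diagram_wf E F : same_diagram E F -> wf_code E = wf_code F.
Proof.
elim=> {E F} [//|E F _ -> //|E F G _ -> _ -> //|E1 m n E2|E1 m n E2 mn|f E f_inj|x y' E wf xy].
- by apply: wf_perm; code_perm.
- apply: wf_perm; rewrite !labels_cat /labels /= perm_cat2l perm_cat2r perm_sym.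
  exact: labels_same_node.
- by rewrite wf_relabel.
- by rewrite wf; symmetry; apply: wf_contract.
Qed.

Lemma same_diagram_sum E F : same_diagram E F -> wf_code E -> RQ E = RQ F.
Proof.
elim=> {E F} [//|E F EF IH wF|E F G EF IH1 FG IH2 wE|E1 m n E2 wE|E1 m n E2 mn wE|f E f_inj wE|x y' E wf xy _].
- by rewrite IH // (same_diagram_wf EF).
- by rewrite IH1 // IH2 // -(same_diagram_wf EF).
- rewrite /RQ !state_sum_cat; apply: eq_state_sum => F pF /=.
  (* Once the two summations are exchanged, corresponding states differ only by the order of their
     nodes. *)
  rewrite node_sum_swap; apply: eq_node_sum => B pB; apply: eq_node_sum => A pA.
  apply: eq_state_sum => G pG; apply: (proj2 (@Q_step_perm _ y z w _ _ _ _ _ _ _)); try by code_perm.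
  rewrite (wf_perm (F' := E1 ++ m :: n :: E2)) // !labels_cat.
  by rewrite /labels /= in pF pA pB pG *; rewrite !perm_cat.
- rewrite /RQ !state_sum_cat; apply: eq_state_sum => F pF /=.
  have step A B : same_piece A B -> perm_eq (labels B) (ports m) ->
      state_sum u E2 (fun G => Q (F ++ B ++ G) y z w) =
      state_sum u E2 (fun G => Q (F ++ A ++ G) y z w).
    move=> AB pB; apply: eq_state_sum => G pG; symmetry.
    apply: (proj2 (@Q_step_piece _ y z w A B F G AB _)); case: AB => pl _ _ _.
    rewrite (wf_perm (F' := E1 ++ m :: E2)) // !labels_cat.
    by rewrite /labels /= in pF pB pG pl *; rewrite !perm_cat // (perm_trans pl).
  have [nc|] := boolP (is_classical m); last first.
    move=> nc; have nc' : ~~ is_classical n by case: mn nc.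
    rewrite !node_sum_pure //; apply: step; first exact: same_piece_node.
    by rewrite /labels /= cats0.
  case: mn nc step => //= a b c d _ step; apply: eq_bigr => s _; congr (_ * _)%R.
  by apply: step; [exact: same_piece_smooth|case: s => [[]|]; code_perm].
- rewrite /RQ state_sum_relabel; apply: eq_state_sum => F pF.
  by apply: (proj2 (@Q_step_relabel _ y z w _ F f_inj _)); rewrite (wf_perm pF).
rewrite /RQ [LHS]/= state_sum_relabel; apply: eq_state_sum => F pF.
apply: (proj2 (@Q_step_contract _ y z w _ _ F xy _)); rewrite (wf_perm (F' := Joint x y' :: E)) //.
by rewrite /labels /= in pF *; rewrite !perm_cons.
Qed.

Lemma not_classical_strand p us q : ~~ has is_classical (virtual_strand p us q).
Proof. by elim: us p => [|[[x x'] s] us IH] p //=. Qed.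

(** For III* and IV* both sides are reduced to a common code [D] in which the moving strands cross
    nothing; for I* and II* one side already has this form. *)
Lemma virtual_move_sum C C' : virtual_move C C' ->
  wf_code C -> wf_code C' -> RQ C = RQ C'.
Proof.
case=> {C C'} [T a b m|T b1 b2 t1 t2 l r|T p1 p2 p3 p4 p5 p6 u1 u2 u3|T p q us ls] wC wC'.
- by symmetry; apply: RQ_step => // F; apply: Q_step_I.
- by symmetry; apply: RQ_step => // F; apply: Q_step_II.
- pose D := T ++ [:: Joint p1 p4; Joint p2 p5; Joint p3 p6].
  transitivity (RQ D); [|symmetry]; apply: RQ_step => // F;
    (apply: Q_step_trans;
      last exact: (@Q_step_three_joins _ y z w F p1 u1 p4 p2 u2 p5 p3 u3 p6));
    by apply: Q_step_perm; code_perm.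
pose D := T ++ [:: Vertex (map outer_part us ++ map outer_part ls); Joint p q].
transitivity (RQ D); [|symmetry]; apply: RQ_step => //=; try exact: not_classical_strand.
  by move=> F; apply: (@Q_step_IV _ y z w F [::]).
move=> F; apply: Q_step_trans.
  by have := @Q_step_IV _ y z w F (map outer_part us) [::] q ls p; rewrite !cats0; apply.
(* On this side of IV* the strand is written from [q] to [p], so its joint has to be turned to match
   [D]. *)
have pc : same_piece [:: Joint q p] [:: Joint p q].
  by apply: (same_piece_node (same_joint2 p q)).
have := @Q_step_piece _ y z w _ _ (F ++ [:: Vertex (map outer_part us ++ map outer_part ls)]) [::] pc.
by rewrite -!catA.
Qed.

End Invariance.

Theorem proposition6p10 (E E' : diagram) :
  differ_by_virtual_move E E' -> R E = R E'.
Proof.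
case=> C [C' [EC E'C' move]].
have wC : wf_code C by rewrite -(same_diagram_wf EC) diagram_wf.
have wC' : wf_code C' by rewrite -(same_diagram_wf E'C') diagram_wf.
rewrite !R_state_sum (same_diagram_sum _ _ _ _ EC) ?diagram_wf //.
rewrite (same_diagram_sum _ _ _ _ E'C') ?diagram_wf //.
by case: move => /virtual_move_sum -> .
Qed.
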